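(* There is an algorithm which, given any one-dimensional Peg Solitaire configuration $w\in\{0,1\}^n$, computes in time $O(n)$ a sequence of hops transforming $w$ into a configuration whose number of pegs is the minimum number of pegs among all configurations reachable from $w$ by sequences of hops.
   Context: One-dimensional Peg Solitaire: a configuration is a finite word $w=c_0\cdots c_{n-1}\in\{0,1\}^*$ describing a row of $n$ consecutive sites ($1$ = peg, $0$ = hole); the board consists exactly of these sites. A hop takes three consecutive sites within the board with pegs on one end site and the middle site and a hole on the other end site, moves the end peg into the hole and removes the middle peg ($110\to001$ or $011\to100$). The computational model is the standard RAM model. *)

(* Defs.v *)
From mathcomp Require Import all_boot.
Set Implicit Arguments. Unset Strict Implicit. Unset Printing Implicit Defensive.

(* A configuration c_0 ... c_{n-1}: true = peg, false = hole. *)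
Definition config := seq bool.

(* A hop (i, d) acts on the sites i, i+1, i+2.
   d = true  : 110 -> 001 (peg at i jumps rightwards over i+1 into i+2);
   d = false : 011 -> 100 (peg at i+2 jumps leftwards over i+1 into i). *)
Definition hop := (nat * bool)%type.

Definition apply_hop (w : config) (h : hop) : option config :=
  let: (i, d) := h in
  if i.+2 < size w then
    let a := nth false w i in
    let b := nth false w i.+1 in
    let c := nth false w i.+2 in
    if d then
      (if [&& a, b & ~~ c]
       then Some (set_nth false (set_nth false (set_nth false w i false) i.+1 false) i.+2 true)
       else None)
    else
      (if [&& ~~ a, b & c]
       then Some (set_nth false (set_nth false (set_nth false w i true) i.+1 false) i.+2 false)
       else None)
  else None.

Fixpoint apply_hops (w : config) (hs : seq hop) : option config :=
  match hs with
  | [::] => Some w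
  | h :: hs' => match apply_hop w h with
                | Some w' => apply_hops w' hs'
                | None => None
                end
  end.

Definition reachable (w v : config) : Prop := exists hs, apply_hops w hs = Some v.

Definition pegs (w : config) : nat := count id w.

(* Memory is an infinite array of natural numbers, indexed by naturals.
   Instructions (a, b, d, s are addresses, c a constant, l a program label):
     Const d c   : M[d] := c
     Add d a b   : M[d] := M[a] + M[b]
     Sub d a b   : M[d] := M[a] - M[b]   (truncated)
     LoadI d a   : M[d] := M[M[a]]       (indirect load)
     StoreI a s  : M[M[a]] := M[s]       (indirect store)
     Jz a l      : if M[a] = 0 then jump to l
     Jmp l       : jump to l
     Halt        : stop.
   Every executed instruction costs one time unit. *)
Inductive instr :=
| Const (d c : nat)
| Add (d a b : nat)
| Sub (d a b : nat)
| LoadI (d a : nat)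
| StoreI (a s : nat)
| Jz (a l : nat)
| Jmp (l : nat)
| Halt.

Record state := State { pc : nat; mem : nat -> nat }.

Definition upd (m : nat -> nat) (a v : nat) : nat -> nat :=
  fun x => if x == a then v else m x.

(* One step; None means the machine has halted (Halt, or pc outside the program). *)
Definition step (P : seq instr) (s : state) : option state :=
  let m := mem s in
  let p := pc s in
  match nth Halt P p with
  | Const d c => Some (State p.+1 (upd m d c))
  | Add d a b => Some (State p.+1 (upd m d (m a + m b)))
  | Sub d a b => Some (State p.+1 (upd m d (m a - m b)))
  | LoadI d a => Some (State p.+1 (upd m d (m (m a))))
  | StoreI a x => Some (State p.+1 (upd m (m a) (m x)))
  | Jz a l => Some (State (if m a == 0 then l else p.+1) m)
  | Jmp l => Some (State l m)
  | Halt => None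
  end.

Fixpoint run (t : nat) (P : seq instr) (s : state) : option state :=
  match step P s with
  | None => Some s
  | Some s' => match t with
               | 0 => None
               | t'.+1 => run t' P s'
               end
  end.

(* Input encoding of w = c_0 ... c_{n-1}: M[0] = n, M[i+1] = c_i (0/1),
   all other cells 0; execution starts at instruction 0. *)
Definition init_state (w : config) : state :=
  State 0 (fun x => if x == 0 then size w
                    else if x <= size w then nat_of_bool (nth false w x.-1) else 0).

Definition decode_output (s : state) : seq hop :=
  mkseq (fun j => (mem s (2 * j).+1, mem s (2 * j).+2 != 0)) (mem s 0).

(* Main.v *)
Require Import Defs.
From mathcomp Require Import all_boot.
From mathcomp Require Import zify.
Set Implicit Arguments. Unset Strict Implicit. Unset Printing Implicit Defensive.

(** Every hop merges two neighbouring pegs into one, so the pegs of a reachable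
    configuration stem from consecutive blocks of the initial pegs, each of which
    can be merged into a single peg on an unbounded board.  The words that can be
    so merged form a regular language (Moore and Eppstein), recognised by the
    automaton [delta] below.  Let the cost of a word be the least number of blocks
    of a partition into such words.  A hop never decreases the cost, and as long
    as there is a hole and there are more pegs than the cost, some hop preserves
    it: inside a block by a property of the automaton, except when every block with
    two pegs is 11, and then a pair of pegs can be moved next to a hole.  Hence a
    configuration with a hole and no cost-preserving hop has as many pegs as its
    cost, which is a lower bound for all reachable configurations.

    The cost is a min-plus product of a vector determined by a prefix and a vector
    determined by the remaining suffix, so the effect of a hop is tested in
    constant time when both vectors are stored for every position.  A scan from
    left to right performs every cost-preserving hop it meets and then steps back
    by two sites.  Since each hop removes a peg, it makes at most 4n steps. *)

(** * Blocks that merge into one peg *)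

(* Entry s is (delta s 0, delta s 1).  The states 0 to 14 are the classes of the
   words (empty), 1, 10, 11, 100, 101, 111, 1001, 1010, 1110, 1111, 10101, 11101, 11111,
   111111; the sink is 7 and the states below 5 are accepting. *)
Definition delta_table : seq (nat * nat) :=
  [:: (0, 1); (2, 3); (4, 5); (1, 6); (4, 7); (8, 2); (9, 10); (7, 7);
      (7, 11); (7, 12); (5, 13); (8, 4); (7, 8); (9, 14); (11, 13)].

Definition delta (s : nat) (a : bool) : nat :=
  let p := nth (7, 7) delta_table s in if a then p.2 else p.1.

Definition acc (s : nat) : bool := s < 5.

Arguments delta : simpl never.
Arguments acc : simpl never.

Definition states : seq nat := iota 0 15.

Definition dfa_run (s : nat) (w : config) : nat := foldl delta s w.

(* [w] surrounded by infinitely many holes can be reduced to at most one peg. *)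
Definition mergeable (w : config) : bool := acc (dfa_run 0 w).

Lemma dfa_run_cat s u v : dfa_run s (u ++ v) = dfa_run (dfa_run s u) v.
Proof. exact: foldl_cat. Qed.

Lemma delta_lt s a : delta s a < 15.
Proof.
case: (ltnP s 15) => hs; last by rewrite /delta nth_default //; case: a.
have : all (fun s => all (fun a => delta s a < 15) [:: true; false]) states by [].
by move/allP/(_ s); rewrite mem_iota => /(_ hs) /allP; apply; case: a.
Qed.

Lemma dfa_run_lt w : dfa_run 0 w < 15.
Proof. by elim/last_ind: w => // w a _; rewrite -cats1 dfa_run_cat delta_lt. Qed.

Lemma states_ind (P : pred nat) : all P states -> forall s, s < 15 -> P s.
Proof. by move/allP=> h s hs; apply: h; rewrite mem_iota. Qed.

Lemma mergeable_cons0 w : mergeable (false :: w) = mergeable w.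
Proof. by []. Qed.

(** Reading a hole never changes acceptance, which is checked on each of the fifteen states. *)
Lemma mergeable_rcons0 w : mergeable (rcons w false) = mergeable w.
Proof.
rewrite /mergeable -cats1 dfa_run_cat.
by have /eqP := @states_ind (fun s => acc (delta s false) == acc s) isT _ (dfa_run_lt w).
Qed.

Lemma acc_holes s w : s < 15 -> acc s -> pegs w = 0 -> acc (dfa_run s w).
Proof.
elim: w s => // a w IH s hs h; case: a => //= hw; apply: IH => //; first exact: delta_lt.
by have /implyP := @states_ind (fun s => acc s ==> acc (delta s false)) isT _ hs; apply.
Qed.

Lemma mergeable_single w : pegs w <= 1 -> mergeable w.
Proof.
elim: w => // [[]] w IH h; last by rewrite mergeable_cons0 IH.
by apply: (@acc_holes 1 w) => //; move: h; rewrite /pegs /=; lia.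
Qed.

(* [incl] is the greatest simulation: (p, q) \in incl iff every word accepted
   from p is accepted from q. *)
Definition incl_ok (r : seq (nat * nat)) (pq : nat * nat) : bool :=
  (acc pq.1 ==> acc pq.2) &&
  all (fun a => (delta pq.1 a, delta pq.2 a) \in r) [:: true; false].

Definition incl : seq (nat * nat) :=
  iter 15 (fun r => [seq pq <- r | incl_ok r pq])
    [seq (p, q) | p <- states, q <- states].

Lemma incl_run r p q w : all (incl_ok r) r -> (p, q) \in r -> acc (dfa_run p w) -> acc (dfa_run q w).
Proof.
move=> hr; elim: w p q => [|a w IH] p q /(allP hr) /andP[/implyP h1 /allP h2] //=.
by move=> h; apply: IH h; apply: (h2 a); case: (a).
Qed.

(** * Hops and the automaton *)

Definition win_before (d : bool) : config :=
  if d then [:: true; true; false] else [:: false; true; true].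
Definition win_after (d : bool) : config :=
  if d then [:: false; false; true] else [:: true; false; false].

(** Fifteen refinement rounds from the full relation reach a simulation, as the computation
    confirms. The existential hides the concrete table from later proofs. *)
Lemma incl_hops : exists2 r, all (incl_ok r) r &
  all (fun s => all (fun d =>
    (dfa_run s (win_after d), dfa_run s (win_before d)) \in r) [:: true; false]) states.
Proof. by exists incl; vm_compute. Qed.

(** Whatever state [u] leads to, the simulation shows that [v] is accepted after the original window
    if it is accepted after the hopped one. *)
Lemma mergeable_unhop d u v :
  mergeable (u ++ win_after d ++ v) -> mergeable (u ++ win_before d ++ v).
Proof.
rewrite /mergeable !dfa_run_cat; case: incl_hops => r hr h; apply: (incl_run hr).
by have /allP := states_ind h (dfa_run_lt u); apply; case: (d).
Qed.

(** A hop by factorisation instead of by index, which suits concatenation; [apply_hop_in] and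
    [hop_in_apply] translate between the two forms. *)
Definition hop_in (w w' : config) : Prop :=
  exists u d v, w = u ++ win_before d ++ v /\ w' = u ++ win_after d ++ v.

Lemma hop_in_ctx u v w w' : hop_in w w' -> hop_in (u ++ w ++ v) (u ++ w' ++ v).
Proof.
by case=> [x [d [y [-> ->]]]]; exists (u ++ x), d, (y ++ v); rewrite !catA.
Qed.

(* A probe summarises a word w read so far: its last two letters, most recent
   first, each with the state before it; the state after w; the live states after
   the words one hop away from w; the first three letters of w; and its number of
   pegs capped at 2. *)
Definition probe := (seq (nat * bool) * nat * (seq nat * (config * nat)))%type.

Definition new_states (h : seq (nat * bool)) (c : bool) : seq nat :=
  if h is [:: (_, b); (s, a)] then
    (if [:: a; b; c] == win_before true then [:: dfa_run s (win_after true)] else [::]) ++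
    (if [:: a; b; c] == win_before false then [:: dfa_run s (win_after false)] else [::])
  else [::].

(** Live states are listed in the order of [states], so equal sets give equal probes and the closure
    stays finite. The sink 7 is dropped, as no continuation is accepted from it. *)
Definition probe_step (t : probe) (a : bool) : probe :=
  let: (h, s, (l, (u, n))) := t in
  let l' := [seq delta x a | x <- l] ++ new_states h a in
  (take 2 ((s, a) :: h), delta s a,
   ([seq x <- states | (x != 7) && (x \in l')], (take 3 (rcons u a), minn 2 (n + a)))).

Definition probe0 : probe := ([::], 0, ([::], ([::], 0))).

Definition probe_ok (t : probe) : bool :=
  let: (h, s, (l, (u, n))) := t in
  [&& acc s, n == 2 & u != [:: true; true]] ==> has acc l.

(** Breadth-first closure from the empty word; the pair holds all probes found and the last
    frontier. That sixteen rounds close the set is verified by [probes_ok]. *)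
Definition probes : seq probe :=
  (iter 16 (fun p : seq probe * seq probe =>
     let l := undup [seq t <- [seq probe_step t a | t <- p.2, a <- [:: true; false]]
                       | t \notin p.1] in
     (l ++ p.1, l)) ([:: probe0], [:: probe0])).1.

Definition probes_ok (r : seq probe) : bool :=
  [&& probe0 \in r,
      all (fun t => all (fun a => probe_step t a \in r) [:: true; false]) r &
      all probe_ok r].

Lemma probes_closed : exists r, probes_ok r.
Proof. by exists probes; vm_compute. Qed.

Definition probe_sound (w : config) (t : probe) : Prop :=
  let: (h, s, (l, (u, n))) := t in
  [/\ s = dfa_run 0 w, u = take 3 w, n = minn 2 (pegs w),
      (forall x, x \in l -> exists2 w', hop_in w w' & dfa_run 0 w' = x) &
      (forall p q, h = [:: p; q] ->
         exists2 v, w = v ++ [:: q.2; p.2] & dfa_run 0 v = q.1) /\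
      (forall p, ohead h = Some p -> exists2 v, w = rcons v p.2 & dfa_run 0 v = p.1)].

Lemma probe_step_sound w a t :
  probe_sound w t -> probe_sound (rcons w a) (probe_step t a).
Proof.
case: t => [[h s] [l [u n]]] [-> -> -> hl [hh1 hh2]]; split.
- by rewrite -cats1 dfa_run_cat.
- by case: (w) => [|? [|? [|? ?]]] //=; rewrite !take0.
- by rewrite /pegs -cats1 count_cat /=; lia.
- move=> x; rewrite mem_filter => /andP[/andP[_ hx] _].
  move: hx; rewrite mem_cat => /orP[/mapP[y /hl[w' hw <-] ->]|].
    exists (rcons w' a); last by rewrite -cats1 dfa_run_cat.
    by rewrite -!cats1; apply: (hop_in_ctx [::] [:: a]).
  case: h hh1 hh2 => [|[y b] [|[z c] [|]]] // hh1 _.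
  case: (hh1 _ _ erefl) => v /= -> <- {hh1}.
  rewrite mem_cat => /orP[]; case: eqP => //= -[-> -> ->]; rewrite mem_seq1 => /eqP->.
    exists (v ++ win_after true); last by rewrite dfa_run_cat.
    by exists v, true, [::]; rewrite -cats1 -!catA.
  exists (v ++ win_after false); last by rewrite dfa_run_cat.
  by exists v, false, [::]; rewrite -cats1 -!catA.
split=> [p q|p /=]; last by case=> <-; exists w.
case: h hh2 {hh1} => [|[y b] h] //= hh2; case=> <- ; rewrite take0 => -[<-] /=.
by case: (hh2 _ erefl) => v /= -> <-; exists v => //; rewrite -!cats1 -catA.
Qed.

Lemma probe_run_sound r w : probes_ok r -> let t := foldl probe_step probe0 w in
  probe_sound w t /\ probe_ok t.
Proof.
case/and3P => h0 /allP hs /allP ho.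
have: probe_sound w (foldl probe_step probe0 w) /\ foldl probe_step probe0 w \in r.
  elim/last_ind: w => [|w a [h1 h2]].
    by split=> //; split=> //; split=> // p q.
  rewrite foldl_rcons; split; first exact: probe_step_sound.
  by have /allP := hs _ h2; apply; case: (a).
by case=> h1 /ho.
Qed.

(** Only finitely many probes occur and all satisfy [probe_ok]. An accepting state in the list of
    live states comes from an actual hop by [probe_sound]. *)
Lemma mergeable_hop w : mergeable w -> 1 < pegs w -> w != [:: true; true] ->
  exists2 w', hop_in w w' & mergeable w'.
Proof.
move=> hm hp hw; have [r /(probe_run_sound w)] := probes_closed.
case: (foldl _ _ _) => [[h s] [l [u n]]] [[es eu en hl _]] /=.
rewrite es -/(mergeable w) hm en (minn_idPl hp) eqxx eu /=.
(* Three letters suffice to tell the word 11 from every other word. *)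
have -> : (take 3 w != [:: true; true]).
  by move: hw; case: w {hm hp es eu en hl} => [|? [|? [|? ?]]].
by case/hasP => x /hl [w' h1 <-] h2; exists w'.
Qed.

(** * Partitions into mergeable blocks *)

Definition splits (w : config) (k : nat) : Prop :=
  exists bs, [/\ flatten bs = w, all mergeable bs & size bs <= k].

Lemma splits_cat u v j k : splits u j -> splits v k -> splits (u ++ v) (j + k).
Proof.
case=> [bs [<- hb sb]] [cs [<- hc sc]]; exists (bs ++ cs).
by rewrite flatten_cat all_cat hb hc size_cat; split=> //; lia.
Qed.

Lemma splits_block b : mergeable b -> splits b 1.
Proof. by exists [:: b]; rewrite /= cats0; split=> //; rewrite andbT. Qed.

Lemma splits_cons b v k : mergeable b -> splits v k -> splits (b ++ v) k.+1.
Proof. by move=> /splits_block; apply: splits_cat. Qed.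

Lemma splits_le w j k : j <= k -> splits w j -> splits w k.
Proof. by move=> h [bs [h1 h2 h3]]; exists bs; split=> //; lia. Qed.

Lemma splits_blocks bs : all mergeable bs -> splits (flatten bs) (size bs).
Proof. by exists bs. Qed.

Lemma splits_behead0 w k : splits (false :: w) k -> splits w k.
Proof.
case=> bs [+ + +]; elim: bs k => // -[|a b] bs IH k /= h1 h2 h3.
  by apply: (@splits_le _ k.-1); [lia | apply: IH => //; lia].
case: h1 h2 h3 => -> <- /andP[hb hbs] h3.
by exists (b :: bs); split=> //=; rewrite -mergeable_cons0 hb.
Qed.

(** Leading holes leave the automaton in state 0, so a block that starts with a peg may be read as
    starting with 001, which comes from 110 by a hop. *)
Lemma splits_grow1 v k : splits (true :: v) k -> splits (win_before true ++ v) k.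
Proof.
case=> bs [+ + +]; elim: bs k => // -[|a b] bs IH k /= h1 h2 h3.
  by apply: (@splits_le _ k.-1); [lia | apply: IH => //; lia].
case: h1 h2 h3 => -> <- /andP[hb hbs] h3.
exists ((win_before true ++ b) :: bs); split=> //=.
by rewrite hbs andbT; apply: (@mergeable_unhop true [::] b).
Qed.

(** A partition after the hop is turned into one before the hop. Only the blocks that meet the
    window change, and their number does not grow. *)
Lemma splits_unhop w w' k : hop_in w w' -> splits w' k -> splits w k.
Proof.
case=> u [d [v [-> ->]]] [bs [+ + +]]; elim: bs u k => [|b bs IH] u k.
  by move=> /(congr1 size); rewrite /= !size_cat; case: d => /=; lia.
move=> /= h1 /andP[hb hbs] hs; have {}hs : size bs < k by [].
case: k hs => // k hs.
(* A block that ends before the window is kept, and the induction continues behind it. *)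
case: (leqP (size b) (size u)) => sb.
  have eu : u = b ++ drop (size b) u.
    rewrite -{1}(cat_take_drop (size b) u); congr (_ ++ _).
    by have := congr1 (take (size b)) h1; rewrite take_size_cat // takel_cat // => ->.
  move: h1; rewrite eu -!catA => /eqP; rewrite eqseq_cat // eqxx => /eqP h1.
  by apply: splits_cons => //; apply: IH.
have eb : b = u ++ drop (size u) b.
  rewrite -{1}(cat_take_drop (size u) b); congr (_ ++ _).
  by have := congr1 (take (size u)) h1; rewrite (takel_cat _ (ltnW sb)) take_size_cat.
have nb : drop (size u) b != [::] by rewrite -size_eq0 size_drop subn_eq0 -ltnNge.
have hsp : splits (flatten bs) k by exists bs.
move: (drop (size u) b) eb nb => b2 eb nb {sb IH}.
move: h1; rewrite {}eb -!catA in hb * => /eqP; rewrite eqseq_cat // eqxx => /eqP.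
(* The first block meets one, two or all three sites of the window. If it ends inside 001, it loses
   its trailing holes and 110 goes to the following blocks; if it ends inside 100, it takes the
   whole window as 011 and the following blocks lose their leading holes. *)
case: b2 hb nb => // x [|y [|z b2]] hb _; case: d => //=.
- case=> ex e; rewrite {}ex {}e in hb hsp *.
  move: hb; rewrite cats1 mergeable_rcons0 => hb; apply: splits_cons => //.
  by apply: splits_grow1; apply: splits_behead0.
- case=> ex e; rewrite {}ex {}e in hb hsp *.
  have := @splits_cons (u ++ win_before false) v k; rewrite -catA; apply; last first.
    by do 2 apply: splits_behead0.
  rewrite -[win_before _]cats0; apply: mergeable_unhop; rewrite cats0.
  have := hb; rewrite -mergeable_rcons0 -mergeable_rcons0 -!cats1 -!catA //.
- case=> ex ey e; rewrite {}ex {}ey {}e in hb hsp *.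
  have {}hb : mergeable u.
    by rewrite -mergeable_rcons0 -mergeable_rcons0 -!cats1 -!catA.
  by apply: splits_cons => //; apply: splits_grow1.
- case=> ex ey e; rewrite {}ex {}ey {}e in hb hsp *.
  have := @splits_cons (u ++ win_before false) v k; rewrite -catA; apply; last first.
    by apply: splits_behead0.
  rewrite -[win_before _]cats0; apply: mergeable_unhop; rewrite cats0.
  by have := hb; rewrite -mergeable_rcons0 -!cats1 -!catA.
- case=> ex ey ez <-; rewrite {}ex {}ey {}ez in hb.
  have := @splits_cons (u ++ win_before true ++ b2) (flatten bs) k; rewrite -!catA; apply=> //.
  exact: mergeable_unhop.
- case=> ex ey ez <-; rewrite {}ex {}ey {}ez in hb.
  have := @splits_cons (u ++ win_before false ++ b2) (flatten bs) k; rewrite -!catA; apply=> //.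
  exact: mergeable_unhop.
Qed.

Lemma splits_cons0 w k : 0 < k -> splits w k -> splits (false :: w) k.
Proof.
move=> hk [[|b bs] [<- hb hs]]; first exact: (@splits_le _ 1) (@splits_block [:: false] isT).
by exists ((false :: b) :: bs).
Qed.

(** One block per peg, with the holes attached to blocks; a word of holes alone takes one block,
    hence the maximum with 1. *)
Lemma splits_pegs w : splits w (maxn 1 (pegs w)).
Proof.
elim: w => [|[] w IH]; first by exists [::].
  case: (posnP (pegs w)) => hw.
    apply: (@splits_le _ 1); first by lia.
    by apply/splits_block/mergeable_single; rewrite /pegs /= -/(pegs w) hw.
  apply: (@splits_le _ (pegs w).+1); first by rewrite /pegs /=; lia.
  by apply: (@splits_cons [:: true]) => //; apply: splits_le IH; lia.
by apply: splits_cons0 => //; rewrite /pegs /=; lia.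
Qed.

(** The mergeable blocks to which [mergeable_hop] does not apply. *)
Definition simple (b : config) : bool := (pegs b <= 1) || (b == [:: true; true]).

Lemma simple_mergeable b : simple b -> mergeable b.
Proof. by case/orP => [/mergeable_single|/eqP->]. Qed.

Lemma all_simple_mergeable bs : all simple bs -> all mergeable bs.
Proof. by apply: sub_all => b; apply: simple_mergeable. Qed.

(** * Hops that keep the number of blocks *)

Definition improvable (w : config) (k : nat) : Prop :=
  exists2 w', hop_in w w' & splits w' k.

Lemma improvable_le w j k : j <= k -> improvable w j -> improvable w k.
Proof. by move=> h [w' h1 h2]; exists w' => //; apply: splits_le h2. Qed.

Lemma improvable_cons b w k : mergeable b -> improvable w k -> improvable (b ++ w) k.+1.
Proof.
move=> hb [w' h1 h2]; exists (b ++ w'); last exact: splits_cons.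
by have := hop_in_ctx b [::] h1; rewrite !cats0.
Qed.

Lemma improvable_hop u d v k :
  splits (u ++ win_after d ++ v) k -> improvable (u ++ win_before d ++ v) k.
Proof. by move=> h; exists (u ++ win_after d ++ v) => //; exists u, d, v. Qed.

(** The pair passes a single peg by regrouping 11 1 as 1 11, and a further pair takes over its role.
    Once a block with a hole follows, either 110 or 1110 is met, and a hop to the right keeps the
    number of blocks. *)
Lemma improvable_right bs : all simple bs -> false \in flatten bs ->
  improvable ([:: true; true] ++ flatten bs) (size bs).+1.
Proof.
elim: bs => // b bs IH /= /andP[/orP[hb|/eqP->] hbs]; last first.
  rewrite mem_cat /= => h; apply: (@improvable_cons [:: true; true]) => //.
  exact: IH.
have sbs := splits_blocks (all_simple_mergeable hbs).
case: b hb => [|[] b] hb.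
- by move=> h; apply: improvable_le (IH hbs h).
- case: b hb => [|[] b] hb; last first.
  + move=> _; apply: (@improvable_hop [:: true] true (b ++ flatten bs)).
    apply: (@splits_cons [:: true]) => //.
    apply: (@splits_cons (win_after true ++ b) (flatten bs)) => //.
    by apply: mergeable_single; move: hb; rewrite /pegs /=; lia.
  + by exfalso; move: hb; rewrite /pegs /=; lia.
  + rewrite /= in_cons /= => h; apply: (@improvable_cons [:: true]) => //.
    exact: IH.
move=> _; apply: (@improvable_hop [::] true (b ++ flatten bs)).
apply: (@splits_cons (win_after true)) => //; apply: splits_cons => //.
exact: mergeable_single.
Qed.

(** All letters are pegs, so regrouping 1 11 as 11 1 brings the pair to the front. *)
Lemma front_pair bs : all simple bs -> false \notin flatten bs ->
  [:: true; true] \in bs ->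
  exists cs, [/\ flatten bs = [:: true; true] ++ flatten cs, all simple cs & size bs = (size cs).+1].
Proof.
elim: bs => // b bs IH /= /andP[hb hbs]; rewrite mem_cat negb_or in_cons => /andP[nb nbs].
case: eqP => [<- _|hn /= hin]; first by exists bs.
case: (IH hbs nbs hin) => cs [e1 h1 h2].
have: b = [::] \/ b = [:: true].
  case: b hb nb hn => [|[] [|[] [|? b]]] //=; try by [left | right | rewrite !inE].
case=> ->; last by exists ([:: true] :: cs); rewrite /= e1 h2.
by exists ([::] :: cs); rewrite /= e1 h2.
Qed.

(** The pair is brought next to [b]. If [b] ends in a hole, the pair hops into it; if it ends in its
    only peg, the letter before is a hole and that peg and its right neighbour form the window
    011. *)
Lemma improvable_left b bs : pegs b <= 1 -> false \in b -> all simple bs ->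
  false \notin flatten bs -> [:: true; true] \in bs ->
  improvable (b ++ flatten bs) (size bs).+1.
Proof.
move=> pb hb hbs nbs /(front_pair hbs nbs)[cs [-> hcs ->]].
have scs := splits_blocks (all_simple_mergeable hcs).
case/lastP: b pb hb => // b [] pb; last first.
  move=> _; rewrite cat_rcons; apply: (@improvable_hop b false (flatten cs)).
  have pb' : pegs b <= 1 by move: pb; rewrite /pegs -cats1 count_cat /=; lia.
  apply: splits_cons; first exact: mergeable_single.
  exact: (@splits_cons (win_after false)).
have pb' : pegs b = 0 by move: pb; rewrite /pegs -cats1 count_cat /=; lia.
rewrite mem_rcons in_cons /=; case/lastP: b pb' {pb} => // b [] pb.
  by move: pb; rewrite /pegs -cats1 count_cat /=; lia.
have {}pb : pegs b = 0 by move: pb; rewrite /pegs -cats1 count_cat /=; lia.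
move=> _; rewrite !cat_rcons; apply: (@improvable_hop b false (true :: flatten cs)).
rewrite catA; apply: splits_cons.
  by apply: mergeable_single; rewrite /pegs count_cat -/(pegs b) pb.
exact: (@splits_cons [:: true]).
Qed.

Lemma improvable_simple bs : all simple bs -> [:: true; true] \in bs ->
  false \in flatten bs -> improvable (flatten bs) (size bs).
Proof.
elim: bs => // b bs IH /= /andP[hb hbs]; rewrite in_cons mem_cat.
case: eqP => [<- _ /= |nb /= hin]; first exact: improvable_right.
case: (boolP (false \in flatten bs)) => h.
  by move=> _; apply: improvable_cons; [exact: simple_mergeable | exact: IH].
rewrite orbF => hf; apply: improvable_left => //.
by move: hb; rewrite /simple; case: eqP => [e|]; rewrite ?orbF //; case: nb.
Qed.

(** A block that is not simple has a hop of its own by [mergeable_hop]; if all blocks are simple, a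
    pair is moved to a hole. *)
Lemma improvable_splits w k : false \in w -> splits w k -> k < pegs w -> improvable w k.
Proof.
move=> hf [bs [e hm hs]] hk; rewrite -{w}e in hf hk *; apply: (improvable_le hs).
case: (boolP (all simple bs)) => hsm.
  (* Without a block 11 every simple block has at most one peg, so there would be at most [k]
     pegs. *)
  apply: improvable_simple => //; apply: contraLR hk => hin; rewrite -leqNgt.
  apply: leq_trans hs; elim: bs {hf hm} hsm hin => //= b bs IH /andP[hb hbs].
  rewrite in_cons negb_or => /andP[h1 h2]; rewrite /pegs count_cat.
  have := IH hbs h2; rewrite /pegs; move: hb; rewrite /simple eq_sym (negbTE h1) orbF /pegs; lia.
case/allPn: hsm => b hin; rewrite negb_or -ltnNge => /andP[h1 h2].
case/splitPr: hin hm {hf hk} => b1 b2; rewrite all_cat /= => /and3P[m1 m m2].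
have [b' hop mb'] := mergeable_hop m h1 h2.
exists (flatten (b1 ++ b' :: b2)).
  by rewrite !flatten_cat /=; apply: hop_in_ctx.
by exists (b1 ++ b' :: b2); rewrite all_cat /= m1 mb' m2 !size_cat.
Qed.

(** * Hops as replacements of windows *)

Definition window (w : config) (i : nat) : config :=
  [:: nth false w i; nth false w i.+1; nth false w i.+2].

Definition replace3 (w : config) (i : nat) (p : config) : config :=
  take i w ++ p ++ drop i.+3 w.

Lemma size_replace3 w i p : i.+2 < size w -> size p = 3 -> size (replace3 w i p) = size w.
Proof. by move=> h hp; rewrite !size_cat size_takel ?size_drop ?hp; lia. Qed.

Lemma nth_replace3 w i p x : i.+2 < size w -> size p = 3 ->
  nth false (replace3 w i p) x =
  if i <= x < i.+3 then nth false p (x - i) else nth false w x.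
Proof.
move=> h hp; rewrite !nth_cat size_takel ?hp; last by lia.
case: (ltnP x i) => hx; first by rewrite nth_take.
case: ifP => hx2; first by have -> : x < i.+3 by lia.
have -> : x < i.+3 = false by lia.
by rewrite nth_drop; congr nth; lia.
Qed.

Lemma replace3_window w i : i.+2 < size w -> replace3 w i (window w i) = w.
Proof.
move=> h; apply: (@eq_from_nth _ false); first by rewrite size_replace3.
move=> x _; rewrite nth_replace3 //; case: ifP => // hx.
have : x = i \/ x = i.+1 \/ x = i.+2 by lia.
by case=> [->|[]->]; rewrite ?subnn ?subSnn //; have -> : i.+2 - i = 2 by lia.
Qed.

Lemma window_replace3 w i p : i.+2 < size w -> size p = 3 -> window (replace3 w i p) i = p.
Proof.
move=> h hp; rewrite /window !nth_replace3 //.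
have -> : i <= i < i.+3 by lia.
have -> : i <= i.+1 < i.+3 by lia.
have -> : i <= i.+2 < i.+3 by lia.
rewrite subnn subSnn; have -> : i.+2 - i = 2 by lia.
by case: p hp => [|? [|? [|? []]]].
Qed.

Lemma take_replace3 w i p j : j <= i -> i.+2 < size w -> take j (replace3 w i p) = take j w.
Proof.
move=> h1 h2; have hs : j <= size (take i w) by rewrite size_takel //; lia.
by rewrite (takel_cat _ hs) take_takel.
Qed.

Lemma drop_replace3 w i p j : i.+2 < j -> i.+2 < size w -> size p = 3 ->
  drop j (replace3 w i p) = drop j w.
Proof.
move=> h1 h2 hp; rewrite /replace3 catA drop_cat size_cat size_takel ?hp; last by lia.
have -> : j < i + 3 = false by lia.
by rewrite drop_drop; congr drop; lia.
Qed.

Lemma replace3_replace3 w i p q : i.+2 < size w -> size p = 3 -> size q = 3 ->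
  replace3 (replace3 w i p) i q = replace3 w i q.
Proof.
move=> h hp hq; have hs := size_replace3 h hp.
apply: (@eq_from_nth _ false); first by rewrite !size_replace3 // hs.
by move=> x _; rewrite !nth_replace3 ?hs //; case: (i <= x < i.+3).
Qed.

Lemma replace3C w i j p q : j.+2 < i -> i.+2 < size w -> size p = 3 -> size q = 3 ->
  replace3 (replace3 w i p) j q = replace3 (replace3 w j q) i p.
Proof.
move=> hj hi hp hq; have hj' : j.+2 < size w by lia.
have hs := size_replace3 hi hp; have hs' := size_replace3 hj' hq.
apply: (@eq_from_nth _ false); first by rewrite !size_replace3 ?hs ?hs'.
move=> x _; rewrite !nth_replace3 ?hs ?hs' //.
by case: ifP => h1 //; case: ifP => // h2; lia.
Qed.

Lemma window_replace3_disj w i j p : j.+2 < i \/ i.+2 < j -> i.+2 < size w -> size p = 3 ->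
  window (replace3 w i p) j = window w j.
Proof.
move=> hj hi hp; rewrite /window !nth_replace3 //.
have -> : i <= j < i.+3 = false by lia.
have -> : i <= j.+1 < i.+3 = false by lia.
by have -> : i <= j.+2 < i.+3 = false by lia.
Qed.

Lemma size_win_after d : size (win_after d) = 3. Proof. by case: d. Qed.
Lemma size_win_before d : size (win_before d) = 3. Proof. by case: d. Qed.

Lemma set_nth3 w i a b c : i.+2 < size w ->
  set_nth false (set_nth false (set_nth false w i a) i.+1 b) i.+2 c =
  replace3 w i [:: a; b; c].
Proof.
move=> h; apply: (@eq_from_nth _ false); first by rewrite size_replace3 // !size_set_nth; lia.
move=> x _; rewrite nth_replace3 // !nth_set_nth /= !nth_set_nth /= nth_set_nth /=.
case: eqP => [->|h2].
  have -> : i <= i.+2 < i.+3 by lia.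
  by have -> : i.+2 - i = 2 by lia.
case: eqP => [->|h1].
  have -> : i <= i.+1 < i.+3 by lia.
  by rewrite subSnn.
case: eqP => [->|h0].
  have -> : i <= i < i.+3 by lia.
  by rewrite subnn.
by have -> : i <= x < i.+3 = false by lia.
Qed.

Lemma apply_hopE w i d : apply_hop w (i, d) =
  if (i.+2 < size w) && (window w i == win_before d)
  then Some (replace3 w i (win_after d)) else None.
Proof.
rewrite /apply_hop /window; case: (ltnP i.+2 (size w)) => //= h; rewrite !set_nth3 //.
by case: (nth false w i) (nth false w i.+1) (nth false w i.+2) d => [] [] [] [].
Qed.

Lemma apply_hopP w i d w' : apply_hop w (i, d) = Some w' ->
  [/\ i.+2 < size w, window w i = win_before d & w' = replace3 w i (win_after d)].
Proof. by rewrite apply_hopE; case: ifP => // /andP[h1 /eqP h2] [<-]. Qed.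

Lemma apply_hop_in w h w' : apply_hop w h = Some w' -> hop_in w w'.
Proof.
case: h => i d /apply_hopP[hi hw ->]; exists (take i w), d, (drop i.+3 w); split=> //.
by rewrite -hw -/(replace3 w i _) replace3_window.
Qed.

Lemma hop_in_apply w w' : hop_in w w' -> exists i d, apply_hop w (i, d) = Some w'.
Proof.
case=> u [d [v [-> ->]]]; exists (size u), d.
have hs : (size u).+2 < size (u ++ win_before d ++ v).
  by rewrite !size_cat size_win_before; lia.
have hw : replace3 (u ++ win_before d ++ v) (size u) = fun p => u ++ p ++ v.
  rewrite /replace3 take_size_cat // catA drop_size_cat //.
  by rewrite size_cat size_win_before; lia.
have := window_replace3 hs (size_win_before d); rewrite hw => e.
by rewrite apply_hopE hs e eqxx hw.
Qed.

Lemma hop_in_pegs w w' : hop_in w w' -> pegs w = (pegs w').+1.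
Proof.
by case=> u [d [v [-> ->]]]; rewrite /pegs !count_cat; case: d => /=; lia.
Qed.

Lemma hop_in_size w w' : hop_in w w' -> size w' = size w.
Proof. by case=> u [d [v [-> ->]]]; rewrite !size_cat; case: d. Qed.

(** * The cost as a min-plus product *)

Definition minl (inf : nat) (l : seq nat) : nat := foldr minn inf l.

Lemma minl_leP inf l k :
  reflect (inf <= k \/ exists2 x, x \in l & x <= k) (minl inf l <= k).
Proof.
apply: (iffP idP).
  elim: l => [|y l IH] /=; first by left.
  rewrite geq_min => /orP[h|/IH[h|[x hx h]]]; first by right; exists y; rewrite ?mem_head.
    by left.
  by right; exists x; rewrite // in_cons hx orbT.
elim: l => [|y l IH] /=; first by case=> // -[].
case=> [h|[x]]; first by rewrite geq_min IH ?orbT //; left.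
rewrite in_cons geq_min => /orP[/eqP->->//|hx h]; rewrite IH ?orbT //; right.
by exists x.
Qed.

(* An edge either continues the current block, or closes it and opens a new one,
   which has weight 1. *)
Definition out_edges (a : bool) (s : nat) : seq (nat * nat) :=
  (delta s a, 0) :: (if acc s then [:: (delta 0 a, 1)] else [::]).

Definition in_edges (a : bool) (s' : nat) : seq (nat * nat) :=
  [seq (e.1, e.2.2) | e <- [seq (s, p) | s <- states, p <- out_edges a s] & e.2.1 == s'].

Lemma in_edgesP a s s' c : (s, c) \in in_edges a s' = (s \in states) && ((s', c) \in out_edges a s).
Proof.
apply/mapP/andP => [[[s1 [s2 c2]]]|[h1 h2]].
  rewrite mem_filter => /andP[/eqP es /allpairsPdep[s3 [p [h1 h2 e]]]].
  by case: e h1 h2 es => -> <- h1 h2 /= <- [-> ->].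
exists (s, (s', c)) => //; rewrite mem_filter eqxx.
by apply/allpairsPdep; exists s, (s', c).
Qed.

(* [inf] stands for infinity; values are only meaningful below it. *)
Definition back_step (inf : nat) (a : bool) (y : nat -> nat) (s : nat) : nat :=
  minl inf [seq y p.1 + p.2 | p <- out_edges a s].

Definition fwd_step (inf : nat) (a : bool) (x : nat -> nat) (s : nat) : nat :=
  minl inf [seq x p.1 + p.2 | p <- in_edges a s].

Definition back0 (inf s : nat) : nat := if acc s then 0 else inf.
(** The value 1 counts the first block; later blocks are counted by the edges that open them. *)
Definition fwd0 (inf s : nat) : nat := if s == 0 then 1 else inf.

(** [back inf v s] is the least number of blocks still to be opened when [v] is read from state [s]
    of an open block; [fwd inf u s] is the least number of blocks opened when reading [u] ends in
    state [s]. *)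
Definition back (inf : nat) (v : config) : nat -> nat := foldr (back_step inf) (back0 inf) v.
Definition fwd (inf : nat) (u : config) : nat -> nat :=
  foldl (fun x a => fwd_step inf a x) (fwd0 inf) u.

Lemma back_cons inf a v : back inf (a :: v) = back_step inf a (back inf v).
Proof. by []. Qed.

Definition dot (inf : nat) (x y : nat -> nat) : nat :=
  minl inf [seq x s + y s | s <- states].

Lemma eq_leq_all m n : (forall k, (m <= k) = (n <= k)) -> m = n.
Proof. by move=> h; apply/eqP; rewrite eqn_leq h leqnn -h leqnn. Qed.

(** [in_edges] transposes [out_edges], so this is the adjointness of a min-plus matrix and its
    transpose, proved by comparing both sides with every bound [k]. *)
Lemma dot_step inf a x y : dot inf (fwd_step inf a x) y = dot inf x (back_step inf a y).
Proof.
apply: eq_leq_all => k; apply/minl_leP/minl_leP; case=> [|[_ /mapP[s hs ->] h]]; try by left.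
  have /minl_leP : fwd_step inf a x s <= k - y s by lia.
  case=> [|[_ /mapP[[s1 c] + ->]]]; first by left; lia.
  rewrite in_edgesP => /andP[h1 h2] h3; rewrite /= in h3; right; exists (x s1 + back_step inf a y s1).
    by apply/mapP; exists s1.
  suff : back_step inf a y s1 <= y s + c by lia.
  by apply/minl_leP; right; exists (y s + c) => //; apply/mapP; exists (s, c).
have /minl_leP : back_step inf a y s <= k - x s by lia.
case=> [|[_ /mapP[[s1 c] h2 ->] h3]]; first by left; lia.
rewrite /= in h3; right; exists (fwd_step inf a x s1 + y s1).
  apply/mapP; exists s1 => //; rewrite mem_iota /=.
  by move: h2; rewrite /out_edges in_cons; case: (acc s);
    rewrite ?mem_seq1 => /orP[] // /eqP[-> _]; exact: delta_lt.
suff : fwd_step inf a x s1 <= x s + c by lia.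
apply/minl_leP; right; exists (x s + c) => //; apply/mapP; exists (s, c) => //.
by rewrite in_edgesP hs.
Qed.

Definition cost (inf : nat) (w : config) : nat := dot inf (fwd0 inf) (back inf w).

(** By [dot_step] letters cross the cut one at a time, so the product is the same at every
    position. *)
Lemma dot_fwd_back inf u v : dot inf (fwd inf u) (back inf v) = cost inf (u ++ v).
Proof.
elim/last_ind: u v => // u a IH v.
by rewrite /fwd foldl_rcons dot_step cat_rcons -(IH (a :: v)).
Qed.

(** [b] completes the block that is open in state [s], and each block in [bs] accounts for at most
    one edge of weight 1. *)
Lemma back_leP inf s v k : k < inf ->
  back inf v s <= k <->
  exists b bs, [/\ v = b ++ flatten bs, acc (dfa_run s b), all mergeable bs & size bs <= k].
Proof.
move=> hk; split.
  elim: v s k hk => [|a v IH] s k hk.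
    by rewrite /= /back0; case: ifP => [h _|_]; [exists [::], [::] | lia].
  rewrite back_cons => /minl_leP[|[_ /mapP[p hp ->]]]; first by lia.
  move: hp; rewrite /out_edges in_cons => /orP[/eqP-> /= h|].
    have /IH[//|b [bs [-> h1 h2 h3]]] : back inf v (delta s a) <= k by rewrite addn0 in h.
    by exists (a :: b), bs.
  case: ifP => // hs; rewrite mem_seq1 => /eqP-> /= h.
  have /IH[|b [bs [-> h1 h2 h3]]] : back inf v (delta 0 a) <= k.-1 by lia.
    by lia.
  by exists [::], ((a :: b) :: bs); split=> //=; [rewrite h2 andbT | lia].
case=> b [bs [-> + + +]].
elim: bs b s k hk => [|c bs IHb] b s k hk.
  elim: b s => [|a b IH] s /= h _ _; first by rewrite /back0 h.
  apply/minl_leP; right; exists (back inf (b ++ [::]) (delta s a) + 0).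
    by apply/mapP; exists (delta s a, 0); rewrite ?mem_head.
  by rewrite addn0; apply: IH.
elim: b s => [|a b IH] s h hbs hs.
  (* An empty block is dropped; otherwise its first letter is read along the edge of weight 1. *)
  case: c hbs hs => [|a c] hbs hs.
    by apply: (IHb [::]) => //; exact: ltnW.
  apply/minl_leP; right; exists (back inf (c ++ flatten bs) (delta 0 a) + 1).
    by apply/mapP; exists (delta 0 a, 1); rewrite // /out_edges (h : acc s) !inE eqxx orbT.
  rewrite addn1; case: k hk hs {IHb} (IHb c (delta 0 a) k.-1) => // k hk hs /= IHb.
  by case/andP: hbs => h1 h2; rewrite ltnS; apply: IHb => //; lia.
apply/minl_leP; right; exists (back inf (b ++ flatten (c :: bs)) (delta s a) + 0).
  by apply/mapP; exists (delta s a, 0); rewrite ?mem_head.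
by rewrite addn0; apply: IH.
Qed.

(** [k] is positive because [fwd0] charges one block even for the empty word. *)
Lemma cost_leP inf w k : 0 < k < inf -> cost inf w <= k <-> splits w k.
Proof.
case/andP=> hk hinf; split.
  case/minl_leP=> [|[_ /mapP[s hs ->]]]; first by lia.
  rewrite /fwd0; case: eqP => [->|_]; last by lia.
  move=> h; have /back_leP[|b [bs [-> h1 h2 h3]]] : back inf w 0 <= k.-1 by lia.
    by lia.
  by exists (b :: bs); split=> //=; [rewrite h2 andbT | lia].
case=> bs [e h1 h2]; apply/minl_leP; right; exists (fwd0 inf 0 + back inf w 0).
  by apply/mapP; exists 0.
suff : back inf w 0 <= k.-1 by rewrite /fwd0 /=; lia.
apply/back_leP; first by lia.
case: bs e h1 h2 => [|b bs] <- h1 h2; first by exists [::], [::].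
by case/andP: h1 => h1 h3; exists b, bs; split=> //; move: h2 => /=; lia.
Qed.

Lemma cost_gt0 inf w : 0 < inf -> 0 < cost inf w.
Proof.
move=> h; rewrite ltnNge; apply/negP=> /minl_leP[|[_ /mapP[s hs ->]]]; first by lia.
by rewrite /fwd0; case: eqP; lia.
Qed.

Lemma cost_pegs inf w : size w < inf -> 1 < inf -> cost inf w <= maxn 1 (pegs w).
Proof.
move=> h h1; apply/cost_leP; last exact: splits_pegs.
by have := count_size id w; rewrite -/(pegs w); lia.
Qed.

Lemma cost_le_inf inf w : cost inf w <= inf.
Proof. by apply/minl_leP; left. Qed.

Lemma cost_hop inf w w' : hop_in w w' -> cost inf w <= cost inf w'.
Proof.
move=> h; case: (ltnP (cost inf w') inf) => hw; last exact: leq_trans (cost_le_inf _ _) hw.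
have hp : 0 < cost inf w' by apply: cost_gt0; lia.
by apply/cost_leP; [lia | apply: splits_unhop h _; apply/cost_leP => //; lia].
Qed.

(** * Scanning for cost-preserving hops *)

Definition clean (inf f : nat) (w : config) (i : nat) : Prop :=
  forall j d w', j < i -> apply_hop w (j, d) = Some w' -> f < cost inf w'.

Lemma clean_next inf f w i : clean inf f w i ->
  (forall d w', apply_hop w (i, d) = Some w' -> f < cost inf w') -> clean inf f w i.+1.
Proof.
move=> h1 h2 j d w'; rewrite ltnS leq_eqVlt => /orP[/eqP->|]; [exact: h2 | exact: h1].
Qed.

(* Hops on disjoint windows commute, so a costly hop stays costly by [cost_hop]. *)
Lemma clean_hop inf f w i d w' : clean inf f w i -> apply_hop w (i, d) = Some w' ->
  clean inf f w' (i - 2).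
Proof.
move=> hc hw j e v' hj hv; have hop := apply_hop_in hw.
case/apply_hopP: hw => hi ew ew'; case/apply_hopP: hv; rewrite {}ew' in hop *.
rewrite size_replace3 ?size_win_after // => hj2.
rewrite window_replace3_disj ?size_win_after //; last by left; lia.
move=> ejw ->; rewrite replace3C ?size_win_after //; last by lia.
set v := replace3 w j (win_after e).
have hv : apply_hop w (j, e) = Some v by rewrite apply_hopE hj2 ejw eqxx.
apply: (leq_trans (hc _ _ _ _ hv)); first by lia.
apply: cost_hop; apply: (@apply_hop_in _ (i, d)).
rewrite apply_hopE size_replace3 ?size_win_after // hi.
by rewrite window_replace3_disj ?size_win_after //; [rewrite ew eqxx | right; lia].
Qed.

(** Once [size w <= i.+2], no window starts at or after [i], so every hop raises the cost above [f],
    and [improvable_splits] excludes more than [f] pegs. *)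
Lemma clean_pegs inf f w i : clean inf f w i -> size w <= i.+2 -> 0 < f < inf ->
  cost inf w <= f -> false \in w -> pegs w <= f.
Proof.
move=> hc hi hf hw h0; rewrite leqNgt; apply/negP=> hp.
have /improvable_splits : splits w f by apply/(cost_leP _ hf).
case/(_ h0 hp) => w' /hop_in_apply[j [d h]] /(cost_leP _ hf) h2.
have := hc j d w' _ h; have [] := apply_hopP h; lia.
Qed.

Lemma apply_hops_rcons w hs h v v' :
  apply_hops w hs = Some v -> apply_hop v h = Some v' ->
  apply_hops w (rcons hs h) = Some v'.
Proof.
elim: hs w => [|g hs IH] w /=; first by case=> -> ->.
by case: (apply_hop w g) => // u; apply: IH.
Qed.

(** * Optimality of a fully scanned configuration *)

Lemma reachable_ind (Q : config -> Prop) w :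
  Q w -> (forall u u', Q u -> hop_in u u' -> Q u') -> forall v, reachable w v -> Q v.
Proof.
move=> h0 hs v [l]; elim: l w h0 => [|h l IH] w h0 /=; first by case=> <-.
by case e: (apply_hop w h) => [u|] //; apply: IH; apply: hs h0 (apply_hop_in e).
Qed.

Lemma clean_optimal inf w v i :
  size w < inf -> 1 < inf -> reachable w v -> cost inf v <= cost inf w ->
  clean inf (cost inf w) v i -> size v <= i.+2 ->
  forall v', reachable w v' -> pegs v <= pegs v'.
Proof.
move=> hs hinf hv hc hcl hi v' hv'.
have hpv : pegs v <= pegs w.
  apply: (reachable_ind (Q := fun u => pegs u <= pegs w)) hv => //.
  by move=> u u' h /hop_in_pegs; lia.
have sv' : size v' = size w.
  apply: (reachable_ind (Q := fun u => size u = size w)) hv' => //.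
  by move=> u u' h /hop_in_size->.
(* Every hop leaves a peg, so a reachable configuration without pegs is [w] itself. *)
case: (posnP (pegs v')) => hp'.
  have : v' = w \/ 0 < pegs v'.
    apply: (reachable_ind (Q := fun u => u = w \/ 0 < pegs u)) hv'; first by left.
    by move=> u u' _ [x [d [y [_ ->]]]]; right; rewrite /pegs !count_cat; case: d => /=; lia.
  by case=> [->|]; lia.
have hF : cost inf w <= pegs v'.
  have h1 : cost inf w <= cost inf v'.
    apply: (reachable_ind (Q := fun u => cost inf w <= cost inf u)) hv' => //.
    by move=> u u' h /(cost_hop inf); lia.
  by have := @cost_pegs inf v'; rewrite sv' => /(_ hs hinf); lia.
case: (boolP (false \in v)) => h0.
  apply: leq_trans hF; apply: (clean_pegs hcl hi) => //.
  have := cost_gt0 w (ltnW hinf); have := @cost_pegs inf w hs hinf.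
  by have := count_size id w; rewrite -/(pegs w); lia.
(* Every hop leaves a hole, so [v] without holes equals [w]; and a hop needs a hole, so nothing but
   [w] is reachable. *)
have hnohop u : hop_in w u -> False.
  move=> hw; have : false \in v; last by rewrite (negbTE h0).
  have : v = w \/ false \in v.
    apply: (reachable_ind (Q := fun u => u = w \/ false \in u)) hv; first by left.
    by move=> x x' _ [y [d [z [_ ->]]]]; right; rewrite !mem_cat; case: d; rewrite ?orbT.
  case=> // ->; case: hw => x [d [y [-> _]]].
  by rewrite !mem_cat; case: d; rewrite ?orbT.
suff : v' = w by move->.
apply: (reachable_ind (Q := fun u => u = w)) hv' => // u u' -> /hnohop //.
Qed.

(** * A while language compiled to the RAM *)

Definition memory := nat -> nat.

(** Exactly [t] steps with no demand to halt, so that executions compose; [steps_run] returns to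
    [run] at a halting state. *)
Fixpoint steps (P : seq instr) (t : nat) (s : state) : option state :=
  if t is t'.+1 then obind (steps P t') (step P s) else Some s.

Lemma steps_add P t u s s' : steps P t s = Some s' -> steps P (t + u) s = steps P u s'.
Proof.
elim: t s => [|t IH] s /=; first by case=> ->.
by case: (step P s) => //= s1; apply: IH.
Qed.

Lemma steps_run P t u s s' : steps P t s = Some s' -> step P s' = None ->
  t <= u -> run u P s = Some s'.
Proof.
elim: t u s => [|t IH] u s /=; first by case=> <- h _; case: u => [|u] /=; rewrite h.
by case: u => // u; case e: (step P s) => [s1|] //= h1 h2 h3; rewrite e; apply: IH.
Qed.

Definition reaches (P : seq instr) (t k : nat) (m : memory) (k' : nat) (m' : memory) : Prop :=
  exists2 t', t' <= t & steps P t' (State k m) = Some (State k' m').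

Lemma reaches_trans P t1 t2 k1 m1 k2 m2 k3 m3 :
  reaches P t1 k1 m1 k2 m2 -> reaches P t2 k2 m2 k3 m3 -> reaches P (t1 + t2) k1 m1 k3 m3.
Proof.
case=> u1 h1 e1 [u2 h2 e2]; exists (u1 + u2); first exact: leq_add.
by rewrite (steps_add u2 e1).
Qed.

Lemma reaches_le P t u k m k' m' : t <= u -> reaches P t k m k' m' -> reaches P u k m k' m'.
Proof. by move=> h [t' h1 h2]; exists t' => //; apply: leq_trans h. Qed.

Lemma reaches_refl P k m : reaches P 0 k m k m.
Proof. by exists 0. Qed.

Definition code_at (P : seq instr) (k : nat) (c : seq instr) : Prop :=
  exists A B, P = A ++ c ++ B /\ size A = k.

Lemma code_at_cat P k c1 c2 :
  code_at P k (c1 ++ c2) -> code_at P k c1 /\ code_at P (k + size c1) c2.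
Proof.
case=> A [B [-> <-]]; split; first by exists A, (c2 ++ B); rewrite -catA.
by exists (A ++ c1), B; rewrite size_cat -!catA.
Qed.

Lemma code_at_cons P k i c :
  code_at P k (i :: c) -> nth Halt P k = i /\ code_at P k.+1 c.
Proof.
rewrite -cat1s => /code_at_cat[[A [B [-> <-]]]]; rewrite addn1 => h; split=> //.
by rewrite nth_cat ltnn subnn.
Qed.

Definition straight (i : instr) : bool :=
  match i with Jz _ _ | Jmp _ | Halt => false | _ => true end.

Definition exec1 (m : memory) (i : instr) : memory :=
  match i with
  | Const d c => upd m d c
  | Add d a b => upd m d (m a + m b)
  | Defs.Sub d a b => upd m d (m a - m b)
  | LoadI d a => upd m d (m (m a))
  | StoreI a x => upd m (m a) (m x)
  | _ => m
  end.

Definition exec (m : memory) (c : seq instr) : memory := foldl exec1 m c.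

Lemma exec_cat m c1 c2 : exec m (c1 ++ c2) = exec (exec m c1) c2.
Proof. exact: foldl_cat. Qed.

Lemma reaches_straight P k c m : code_at P k c -> all straight c ->
  reaches P (size c) k m (k + size c) (exec m c).
Proof.
move=> hc hs; exists (size c) => //.
elim: c k m hc hs => [|i c IH] k m; first by rewrite addn0.
case/code_at_cons=> hi /IH{}IH /= /andP[h1 h2].
have -> : step P (State k m) = Some (State k.+1 (exec1 m i)).
  by rewrite /step /= hi; case: i h1 {hi}.
by rewrite /= IH // addnS.
Qed.

Lemma updE m a v : upd m a v a = v.
Proof. by rewrite /upd eqxx. Qed.

Lemma upd_neq m a v x : x != a -> upd m a v x = m x.
Proof. by rewrite /upd => /negbTE->. Qed.

(* Cells [0, nvars) hold variables, cells [nvars, nregs) are overwritten by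
   the evaluation of expressions, and data live from [nregs] on. *)
Definition nvars := 16.
Definition nregs := 32.

Inductive exp :=
| ECst of nat
| EVar of nat
| EAdd of exp & exp
| ESub of exp & exp
| EMin of exp & exp
| ELd of exp.

Fixpoint eval (m : memory) (e : exp) : nat :=
  match e with
  | ECst c => c
  | EVar r => m r
  | EAdd a b => eval m a + eval m b
  | ESub a b => eval m a - eval m b
  | EMin a b => minn (eval m a) (eval m b)
  | ELd a => m (eval m a)
  end.

Fixpoint wf (d : nat) (e : exp) : bool :=
  (d < nregs) &&
  match e with
  | ECst _ => true
  | EVar r => r < nvars
  | EAdd a b | ESub a b | EMin a b => wf d a && wf d.+1 b
  | ELd a => wf d a
  end.

(** Loads must address data cells, since the scratch cells of the machine may differ from [m]. *)
Fixpoint safe (m : memory) (e : exp) : Prop :=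
  match e with
  | ECst _ | EVar _ => True
  | EAdd a b | ESub a b | EMin a b => safe m a /\ safe m b
  | ELd a => safe m a /\ nregs <= eval m a
  end.

(** Stack discipline: the value ends up in cell [d], and only scratch cells from [d] on are changed.
    A move is an addition to 0, and the minimum is [a - (a - b)] with truncated subtraction. *)
Fixpoint comp (d : nat) (e : exp) : seq instr :=
  match e with
  | ECst c => [:: Const d c]
  | EVar r => [:: Const d 0; Add d d r]
  | EAdd a b => comp d a ++ comp d.+1 b ++ [:: Add d d d.+1]
  | ESub a b => comp d a ++ comp d.+1 b ++ [:: Defs.Sub d d d.+1]
  | EMin a b => comp d a ++ comp d.+1 b ++ [:: Defs.Sub d.+1 d d.+1; Defs.Sub d d d.+1]
  | ELd a => comp d a ++ [:: LoadI d d]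
  end.

Lemma straight_comp d e : all straight (comp d e).
Proof.
elim: e d => //= [a IHa b IHb|a IHa b IHb|a IHa b IHb|a IHa] d;
by rewrite !all_cat IHa ?IHb.
Qed.

Definition agree (m l : memory) : Prop := forall x, ~~ (nvars <= x < nregs) -> m x = l x.

Lemma comp_ok e d m l : nvars <= d -> wf d e -> safe m e -> agree m l ->
  exec l (comp d e) d = eval m e /\
  forall x, ~~ (d <= x < nregs) -> exec l (comp d e) x = l x.
Proof.
(* The three binary operations share one argument, in which [cs] combines the cells [d'] and [d'.+1]
   by [f]. *)
have binop f cs a b d' l' m' :
    (forall d m l, nvars <= d -> wf d a -> safe m a -> agree m l ->
       exec l (comp d a) d = eval m a /\
       forall x, ~~ (d <= x < nregs) -> exec l (comp d a) x = l x) ->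
    (forall d m l, nvars <= d -> wf d b -> safe m b -> agree m l ->
       exec l (comp d b) d = eval m b /\
       forall x, ~~ (d <= x < nregs) -> exec l (comp d b) x = l x) ->
    (forall l'', exec l'' cs d' = f (l'' d') (l'' d'.+1) /\
       forall x, x != d' -> x != d'.+1 -> exec l'' cs x = l'' x) ->
    nvars <= d' -> wf d' a && wf d'.+1 b -> safe m' a /\ safe m' b -> agree m' l' ->
    exec l' (comp d' a ++ comp d'.+1 b ++ cs) d' = f (eval m' a) (eval m' b) /\
    forall x, ~~ (d' <= x < nregs) -> exec l' (comp d' a ++ comp d'.+1 b ++ cs) x = l' x.
  move=> IHa IHb hcs hd /andP[wa wb] [sa sb] hag; rewrite !exec_cat.
  have hb : d'.+1 < nregs by case: (b) wb => [?|?|? ?|? ?|? ?|?] /= /andP[].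
  case: (IHa _ _ _ hd wa sa hag) => a1 a2.
  have hag2 : agree m' (exec l' (comp d' a)).
    by move=> x hx; rewrite a2 ?hag //; move: hx hd; rewrite /nvars /nregs; lia.
  case: (IHb _ _ _ (leqW hd) wb sb hag2) => b1 b2.
  case: (hcs (exec (exec l' (comp d' a)) (comp d'.+1 b))) => c1 c2.
  split; first by rewrite c1 b1 b2 ?a1 //; lia.
  by move=> x hx; rewrite c2 ?b2 ?a2 //; lia.
elim: e d m l => [c|r|a IHa b IHb|a IHa b IHb|a IHa b IHb|a IHa] d m l hd; 
  rewrite [wf _ _]/= => /andP[hdn hw] hs hag.
- by split=> [|x hx]; rewrite /= ?updE ?upd_neq //; lia.
- split=> [|x hx]; last by rewrite /= !upd_neq //; lia.
  rewrite /= !updE upd_neq ?add0n ?hag //; move: hw hd; rewrite /nvars /nregs; lia.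
- apply: (@binop addn) => // l'' /=; split; first by rewrite updE.
  by move=> x h1 h2; rewrite upd_neq.
- apply: (@binop subn) => // l'' /=; split; first by rewrite updE.
  by move=> x h1 h2; rewrite upd_neq.
- apply: (@binop minn) => // l'' /=; split.
    by rewrite updE upd_neq ?updE ?minnE //; lia.
  by move=> x h1 h2; rewrite !upd_neq.
case: hs => sa hn; case: (IHa _ _ _ hd hw sa hag) => a1 a2.
rewrite /= !exec_cat /=; split=> [|x hx].
  rewrite updE a1 a2 ?hag //; move: hn hd; rewrite /nvars /nregs; lia.
by rewrite upd_neq ?a2 //; lia.
Qed.

(** As for [Jz], the first branch of [If] is the one for a zero variable; [While] repeats as long as
    its variable is nonzero. *)
Inductive cmd :=
| Skip
| Assign of nat & exp
| Store of exp & exp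
| Seq of cmd & cmd
| If of nat & cmd & cmd
| While of nat & cmd.

Fixpoint csize (c : cmd) : nat :=
  match c with
  | Skip => 0
  | Assign r e => size (comp nvars e) + 2
  | Store a b => size (comp nvars a) + size (comp nvars.+1 b) + 1
  | Seq a b => csize a + csize b
  | If r a b => csize a + csize b + 2
  | While r a => csize a + 2
  end.

(** Jumps are absolute, so the code depends on its address [k]. In [If] the branch for zero is laid
    out last. *)
Fixpoint compile (k : nat) (c : cmd) : seq instr :=
  match c with
  | Skip => [::]
  | Assign r e => comp nvars e ++ [:: Const nvars.+1 0; Add r nvars nvars.+1]
  | Store a b => comp nvars a ++ comp nvars.+1 b ++ [:: StoreI nvars nvars.+1]
  | Seq a b => compile k a ++ compile (k + csize a) b
  | If r a b => Jz r (k + csize b).+2 :: compile k.+1 b ++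
                Jmp (k + csize b + csize a).+2 :: compile (k + csize b).+2 a
  | While r a => Jz r (k + csize a).+2 :: compile k.+1 a ++ [:: Jmp k]
  end.

Lemma size_compile k c : size (compile k c) = csize c.
Proof.
elim: c k => //= [r e|a b|a IHa b IHb|r a IHa b IHb|r a IHa] k;
by rewrite !size_cat /= ?IHa ?IHb; lia.
Qed.

(* The memory [m] of the semantics is only faithful outside the scratch cells. *)
Definition does (c : cmd) (m : memory) (t : nat) (m' : memory) : Prop :=
  forall P k l, code_at P k (compile k c) -> agree m l ->
    exists2 l', agree m' l' & reaches P t k l (k + csize c) l'.

Lemma does_ext c m1 m2 t m1' m2' :
  m2 =1 m1 -> m1' =1 m2' -> does c m1 t m1' -> does c m2 t m2'.
Proof.
move=> e1 e2 h P k l hc hl; case: (h P k l hc) => [x hx|l' h1 h2]; first by rewrite -e1 hl.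
by exists l' => // x hx; rewrite -e2 h1.
Qed.

Lemma does_le c m t u m' : t <= u -> does c m t m' -> does c m u m'.
Proof.
move=> h hd P k l hc hl; case: (hd P k l hc hl) => l' h1 h2; exists l' => //.
exact: reaches_le h2.
Qed.

Lemma does_skip m : does Skip m 0 m.
Proof. by move=> P k l _ h; exists l; rewrite // addn0; apply: reaches_refl. Qed.

Lemma does_assign r e m : r < nvars -> wf nvars e -> safe m e ->
  does (Assign r e) m (csize (Assign r e)) (upd m r (eval m e)).
Proof.
move=> hr hw hs P k l hc hl; have hst := straight_comp nvars e.
exists (exec l (compile k (Assign r e))); last first.
  rewrite -[csize _](size_compile k); apply: reaches_straight => //=.
  by rewrite all_cat hst.
case: (comp_ok (leqnn _) hw hs hl) => h1 h2 x hx; rewrite exec_cat /=.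
case: (eqVneq x r) => [->|hxr]; first by rewrite !updE upd_neq // h1 addn0.
rewrite !upd_neq ?h2 ?hl //; apply: contraNneq hx => ->; by [].
Qed.

Lemma does_store a b m : wf nvars a -> wf nvars.+1 b -> safe m a -> safe m b ->
  nregs <= eval m a ->
  does (Store a b) m (csize (Store a b)) (upd m (eval m a) (eval m b)).
Proof.
move=> wa wb sa sb hn P k l hc hl.
exists (exec l (compile k (Store a b))); last first.
  rewrite -[csize _](size_compile k); apply: reaches_straight => //=.
  by rewrite !all_cat !straight_comp.
case: (comp_ok (leqnn _) wa sa hl) => a1 a2.
have hl2 : agree m (exec l (comp nvars a)) by move=> x hx; rewrite a2 // hl.
case: (comp_ok (leqnSn _) wb sb hl2) => b1 b2 x hx; rewrite /= !exec_cat /=.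
rewrite b1 b2 ?a1 //.
rewrite /upd; case: eqP => // _; rewrite b2 ?a2 ?hl //.
by move: hx; rewrite /nvars /nregs; lia.
Qed.

Lemma does_seq c1 c2 m1 m2 m3 t1 t2 :
  does c1 m1 t1 m2 -> does c2 m2 t2 m3 -> does (Seq c1 c2) m1 (t1 + t2) m3.
Proof.
move=> h1 h2 P k l /= /code_at_cat[hc1]; rewrite size_compile => hc2 hl.
case: (h1 P k l hc1 hl) => l1 a1 r1; case: (h2 P _ l1 hc2 a1) => l2 a2 r2.
by exists l2 => //; rewrite addnA; apply: reaches_trans r1 r2.
Qed.

Lemma reaches_jmp P k m l : nth Halt P k = Jmp l -> reaches P 1 k m l m.
Proof. by move=> h; exists 1; rewrite //= /step /= h. Qed.

Lemma reaches_jz P k m r l : nth Halt P k = Jz r l ->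
  reaches P 1 k m (if m r == 0 then l else k.+1) m.
Proof. by move=> h; exists 1; rewrite //= /step /= h. Qed.

Lemma does_if r c1 c2 m t m' : r < nvars ->
  (m r = 0 -> does c1 m t m') -> (m r != 0 -> does c2 m t m') ->
  does (If r c1 c2) m (t + 2) m'.
Proof.
move=> hr h1 h2 P k l /= /code_at_cons[hjz] /code_at_cat[hc2].
rewrite size_compile => /code_at_cons[hjmp]; rewrite -addSn addSn => hc1 hl.
have hlr : m r = l r by apply: hl; rewrite /nvars in hr *; lia.
have hj := reaches_jz l hjz; move: hj; rewrite -hlr.
case: eqP => [h0|/eqP h0] hj.
  case: (h1 h0 P _ l hc1 hl) => l' a1 r1; exists l' => //.
  apply: (@reaches_le _ (1 + t)); first by lia.
  by have := reaches_trans hj r1; congr reaches; lia.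
case: (h2 h0 P _ l hc2 hl) => l' a1 r1; exists l' => //.
have := reaches_trans (reaches_trans hj r1) (reaches_jmp l' hjmp).
by move/(@reaches_le _ _ (t + 2)) => h; have := h ltac:(lia); congr reaches; lia.
Qed.

(** The invariant carries a variant [v] that bounds the number of rounds. A round costs the body, a
    [Jz] and a [Jmp]; the exit costs one [Jz]. *)
Lemma does_while (I : memory -> nat -> Prop) r c t : r < nvars ->
  (forall m v, I m v -> m r != 0 ->
     exists m' v', [/\ does c m t m', I m' v' & v' < v]) ->
  forall m v, I m v ->
  exists m' v', [/\ does (While r c) m ((t + 2) * v + 1) m', m' r = 0 & I m' v'].
Proof.
move=> hr hstep m v; have [n] := ubnP v; elim: n m v => // n IH m v hv hI.
case: (eqVneq (m r) 0) => h0.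
  exists m, v; split=> // P k l /= /code_at_cons[hjz _] hl; exists l => //.
  have := reaches_jz l hjz; rewrite -hl ?h0 /=; last by rewrite /nvars in hr *; lia.
  by move/(@reaches_le _ _ ((t + 2) * v + 1)) => h; have := h ltac:(lia); congr reaches; lia.
have [m1 [v1 [d1 I1 hv1]]] := hstep _ _ hI h0.
have [|m2 [v2 [d2 h2 I2]]] := IH m1 v1 _ I1; first by lia.
exists m2, v2; split=> // P k l hc hl.
have hc' := hc; case/code_at_cons: hc' => hjz /code_at_cat[hc1].
rewrite size_compile => /code_at_cons[hjmp _].
have hj := reaches_jz l hjz; move: hj.
rewrite -hl ?(negbTE h0) => [hj|]; last by rewrite /nvars in hr *; lia.
case: (d1 P _ l hc1 hl) => l1 a1 r1.
case: (d2 P k l1 hc a1) => l2 a2 r2; exists l2 => //.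
have := reaches_trans (reaches_trans hj r1) (reaches_trans (reaches_jmp l1 hjmp) r2).
by apply: reaches_le; nia.
Qed.

(** * The program *)

Definition takes (c : cmd) (m : memory) (t : nat) (Q : memory -> Prop) : Prop :=
  exists2 m', does c m t m' & Q m'.

(** The bound for loop-free commands, which execute each instruction at most once. *)
Definition ends (c : cmd) (m : memory) (Q : memory -> Prop) : Prop := takes c m (csize c) Q.

Lemma takes_le c m t u Q : t <= u -> takes c m t Q -> takes c m u Q.
Proof. by move=> h [m' h1 h2]; exists m' => //; apply: does_le h1. Qed.

Lemma takes_seq c1 c2 m t1 t2 Q :
  takes c1 m t1 (fun m' => takes c2 m' t2 Q) -> takes (Seq c1 c2) m (t1 + t2) Q.
Proof. by case=> m1 h1 [m2 h2 h3]; exists m2 => //; apply: does_seq h1 h2. Qed.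

Lemma ends_seq c1 c2 m Q : ends c1 m (fun m' => ends c2 m' Q) -> ends (Seq c1 c2) m Q.
Proof. exact: takes_seq. Qed.

Lemma takes_imp c m t (Q Q' : memory -> Prop) :
  (forall m', Q m' -> Q' m') -> takes c m t Q -> takes c m t Q'.
Proof. by move=> h [m' h1 h2]; exists m' => //; apply: h. Qed.

Lemma ends_imp c m (Q Q' : memory -> Prop) :
  (forall m', Q m' -> Q' m') -> ends c m Q -> ends c m Q'.
Proof. exact: takes_imp. Qed.

Lemma ends_skip m (Q : memory -> Prop) : Q m -> ends Skip m Q.
Proof. by exists m => //; apply: does_skip. Qed.

Lemma ends_assign r e m (Q : memory -> Prop) : r < nvars -> wf nvars e -> safe m e ->
  Q (upd m r (eval m e)) -> ends (Assign r e) m Q.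
Proof. by move=> *; exists (upd m r (eval m e)) => //; apply: does_assign. Qed.

Lemma ends_store a b m (Q : memory -> Prop) :
  wf nvars a -> wf nvars.+1 b -> safe m a -> safe m b -> nregs <= eval m a ->
  Q (upd m (eval m a) (eval m b)) -> ends (Store a b) m Q.
Proof. by move=> *; exists (upd m (eval m a) (eval m b)) => //; apply: does_store. Qed.

Lemma ends_if r c1 c2 m Q : r < nvars ->
  (m r = 0 -> ends c1 m Q) -> (m r != 0 -> ends c2 m Q) -> ends (If r c1 c2) m Q.
Proof.
move=> hr h1 h2; case: (eqVneq (m r) 0) => h.
  case: (h1 h) => m' d1 q; exists m' => //; apply: does_if => // [_|]; last by rewrite h.
  by apply: does_le d1; exact: leq_addr.
case: (h2 h) => m' d1 q; exists m' => //; apply: does_if => // [e|_].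
  by rewrite e in h.
by apply: does_le d1; exact: leq_addl.
Qed.

Lemma takes_while (I : memory -> nat -> Prop) r c m v (Q : memory -> Prop) : r < nvars ->
  I m v ->
  (forall m v, I m v -> m r != 0 -> ends c m (fun m' => exists2 v', I m' v' & v' < v)) ->
  (forall m v, I m v -> m r = 0 -> Q m) ->
  takes (While r c) m ((csize c + 2) * v + 1) Q.
Proof.
move=> hr hI hs hq.
have h m1 v1 : I m1 v1 -> m1 r != 0 ->
    exists m' v', [/\ does c m1 (csize c) m', I m' v' & v' < v1].
  by move=> h1 h2; case: (hs _ _ h1 h2) => m' hd [v' h3 h4]; exists m', v'.
by case: (does_while hr h hI) => m' [v' [h1 h2 h3]]; exists m' => //; apply: hq h3 h2.
Qed.

(* The variables contain S = 128 n, q = 128 i, the head position i, the number of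
   hops made, the cost of the input, and a flag for branching. *)
Local Notation rS := 0 (only parsing).
Local Notation rq := 1 (only parsing).
Local Notation ri := 2 (only parsing).
Local Notation rh := 3 (only parsing).
Local Notation rF := 4 (only parsing).
Local Notation rt := 5 (only parsing).

(** The address [256 n + 128 i + off] in the record of the head; keeping 128 n and 128 i in
    variables avoids multiplication. *)
Definition rec_addr (off : nat) : exp :=
  EAdd (EAdd (EAdd (EVar rS) (EVar rS)) (EVar rq)) (ECst off).

(** The accumulated minimum is the left operand, so the scratch depth does not grow with the list.
    The value 128 n in [rS] serves as infinity. *)
Definition emin (l : seq exp) : exp := foldr (fun e a => EMin a e) (EVar rS) l.

Lemma eval_emin (T : Type) (F : T -> exp) m l :
  eval m (emin [seq F p | p <- l]) = minl (m rS) [seq eval m (F p) | p <- l].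
Proof. by elim: l => //= p l IH; rewrite minnC IH. Qed.

Lemma safe_emin (T : eqType) (F : T -> exp) m l :
  (forall p, p \in l -> safe m (F p)) -> safe m (emin [seq F p | p <- l]).
Proof.
elim: l => //= p l IH h; split; last by apply: h; rewrite mem_head.
by apply: IH => q hq; apply: h; rewrite in_cons hq orbT.
Qed.

Definition store_vec (a : exp) (e : nat -> exp) (l : seq nat) : cmd :=
  foldr (fun s c => Seq (Store (EAdd a (ECst s)) (e s)) c) Skip l.

Definition vec_wf (a : exp) (e : nat -> exp) : bool :=
  all (fun s => wf nvars (EAdd a (ECst s)) && wf nvars.+1 (e s)) states.

Definition vec_upd (m : memory) (b : nat) (g : nat -> nat) : memory :=
  fun x => if b <= x < b + 15 then g (x - b) else m x.

(** Entries are evaluated when others are already written, hence the hypothesis on all memories that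
    equal [m] outside the target vector. *)
Lemma ends_store_vec a e m b g (Q : memory -> Prop) : vec_wf a e -> nregs <= b ->
  (forall m', (forall x, ~~ (b <= x < b + 15) -> m' x = m x) ->
     [/\ safe m' a, eval m' a = b & forall s, s < 15 -> safe m' (e s) /\ eval m' (e s) = g s]) ->
  Q (vec_upd m b g) -> ends (store_vec a e states) m Q.
Proof.
move=> hwf hb hst hQ; exists (vec_upd m b g) => //.
suff h k j m1 : j + k = 15 ->
    (forall x, m1 x = if b <= x < b + j then g (x - b) else m x) ->
    does (store_vec a e (iota j k)) m1 (csize (store_vec a e (iota j k))) (vec_upd m b g).
  by apply: (h 15 0) => // x; have -> : b <= x < b + 0 = false by lia.
elim: k j m1 => [|k IH] j m1 hjk hm1.
  have em : m1 =1 vec_upd m b g.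
    move=> x; rewrite hm1 /vec_upd.
    by have -> : j = 15 by lia.
  exact: (does_ext (frefl _) em (@does_skip m1)).
have [|sa ea hse] := hst m1.
  by move=> x hx; rewrite hm1; have -> : b <= x < b + j = false by lia.
have [|se ee] := hse j; first by lia.
have /andP[w1 w2] := states_ind hwf (ltac:(lia) : j < 15).
have hd := @does_store (EAdd a (ECst j)) (e j) m1 w1 w2.
rewrite [iota _ _]/= [store_vec _ _ _]/=; apply: does_seq.
  by apply: hd => //=; rewrite ea; apply: leq_trans hb _; lia.
apply: IH; first by lia.
move=> x; rewrite /upd /= ea ee hm1; case: eqP => [->|hx].
  have -> : b <= b + j < b + j.+1 by lia.
  by congr g; lia.
by have -> : b <= x < b + j.+1 = (b <= x < b + j) by lia.
Qed.

(* Site j owns the 128 cells from 256 n + 128 j on: its letter at offset 0, the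
   vector of the prefix before j at offset 16 (valid for j <= ix) and the vector of
   the suffix from j at offset 32 (valid for j >= iy).  Hops are listed from
   512 n + 1 on. *)
Record heap (m : memory) (w : config) (hs : seq hop) (ix iy : nat) : Prop := Heap {
  heap_letter : forall j, j < size w -> m (256 * size w + 128 * j) = nth false w j;
  heap_fwd : forall j s, j <= ix -> s < 15 ->
    m (256 * size w + 128 * j + 16 + s) = fwd (128 * size w) (take j w) s;
  heap_back : forall j s, iy <= j <= size w -> s < 15 ->
    m (256 * size w + 128 * j + 32 + s) = back (128 * size w) (drop j w) s;
  heap_out : forall j, j < size hs ->
    m (512 * size w + 2 * j + 1) = (nth (0, false) hs j).1 /\
    m (512 * size w + 2 * j + 2) = (nth (0, false) hs j).2
}.

Definition vars (m : memory) (n i h f : nat) : Prop :=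
  [/\ m rS = 128 * n, m rq = 128 * i, m ri = i, m rh = h & m rF = f].

Definition layout (m : memory) (w : config) (hs : seq hop) (f i ix iy : nat) : Prop :=
  [/\ vars m (size w) i (size hs) f, heap m w hs ix iy, 0 < size w & ix <= size w].

Lemma heap_frame m m' w hs ix iy : 0 < size w ->
  (forall x, nregs <= x -> m' x = m x) -> heap m w hs ix iy -> heap m' w hs ix iy.
Proof.
rewrite /nregs => hw h [h1 h2 h3 h4]; split=> *; rewrite !h ?h1 ?h2 ?h3 //; try lia.
exact: h4.
Qed.

Lemma heap_weaken m w hs ix iy ix' iy' : ix' <= ix -> iy <= iy' ->
  heap m w hs ix iy -> heap m w hs ix' iy'.
Proof. by move=> hx hy [h1 h2 h3 h4]; split=> // *; rewrite ?h2 ?h3 //; lia. Qed.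

Lemma heap_set_fwd m w hs i iy : 0 < size w -> i < size w -> heap m w hs i iy ->
  heap (vec_upd m (256 * size w + 128 * i.+1 + 16) (fwd (128 * size w) (take i.+1 w)))
    w hs i.+1 iy.
Proof.
move=> hw hi [h1 h2 h3 h4]; split=> [j hj|j s hj hlt|j s hj hlt|j hj]; rewrite /vec_upd.
- by case: ifP => [|_]; [lia | exact: h1].
- case: ifP => hx; last by rewrite h2 //; lia.
  have ej : j = i.+1 by lia.
  by rewrite ej; congr fwd; lia.
- by case: ifP => [|_]; [lia | exact: h3].
by do 2 (case: ifP => [|_]; first lia); exact: h4.
Qed.

Lemma heap_set_back m w hs ix i : 0 < size w -> i <= size w -> ix <= size w ->
  heap m w hs ix i.+1 ->
  heap (vec_upd m (256 * size w + 128 * i + 32) (back (128 * size w) (drop i w)))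
    w hs ix i.
Proof.
move=> hw hi hix [h1 h2 h3 h4]; split=> [j hj|j s hj hlt|j s hj hlt|j hj]; rewrite /vec_upd.
- by case: ifP => [|_]; [lia | exact: h1].
- by case: ifP => [|_]; [lia | exact: h2].
- case: ifP => hx; last by rewrite h3 //; lia.
  have ej : j = i by lia.
  by rewrite ej; congr back; lia.
by do 2 (case: ifP => [|_]; first lia); exact: h4.
Qed.

Definition upd3 (m : memory) (b : nat) (p : config) : memory :=
  upd (upd (upd m b (nth false p 0)) (b + 128) (nth false p 1)) (b + 256) (nth false p 2).

(** Prefixes up to [i] and suffixes from [i.+3] on do not contain the rewritten letters, so their
    vectors stay valid. *)
Lemma heap_write m w hs i ix iy p : i.+2 < size w -> size p = 3 -> ix <= i -> iy <= i.+3 ->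
  heap m w hs ix iy ->
  heap (upd3 m (256 * size w + 128 * i) p) (replace3 w i p) hs ix i.+3.
Proof.
move=> hi hp hix hiy [h1 h2 h3 h4].
split=> [j|j s|j s|j]; rewrite size_replace3 // /upd3 /upd => hj; try move=> hlt.
- rewrite nth_replace3 //; do 3 (case: eqP => ?; first by
    rewrite (_ : i <= j < i.+3); [congr (nat_of_bool (nth _ _ _)); lia | lia]).
  by rewrite (_ : i <= j < i.+3 = false); [exact: h1 | lia].
- do 3 (case: eqP => ?; first by lia).
  by rewrite take_replace3 ?h2 //; lia.
- do 3 (case: eqP => ?; first by lia).
  by rewrite drop_replace3 ?h3 //; lia.
do 3 (case: eqP => ?; first by lia); do 3 (case: eqP => ?; first by lia).
exact: h4.
Qed.

Lemma heap_emit m w hs ix iy i (d : bool) : 0 < size w -> ix <= size w -> heap m w hs ix iy ->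
  heap (upd (upd m (512 * size w + 2 * size hs + 1) i) (512 * size w + 2 * size hs + 2) d)
    w (rcons hs (i, d)) ix iy.
Proof.
move=> hw hix [h1 h2 h3 h4].
split=> [j hj|j s hj hlt|j s hj hlt|j]; rewrite /upd.
- by do 2 (case: eqP => ?; first by lia); exact: h1.
- by do 2 (case: eqP => ?; first by lia); exact: h2.
- by do 2 (case: eqP => ?; first by lia); exact: h3.
rewrite size_rcons ltnS nth_rcons => hj; case: (ltnP j (size hs)) => hj2.
  by do 4 (case: eqP => ?; first by lia); exact: h4.
have -> : j = size hs by lia.
by rewrite !eqxx; case: eqP => // ?; lia.
Qed.

Lemma layout_frame m m' w hs f f' i i' ix iy : layout m w hs f i ix iy ->
  (forall x, nregs <= x -> m' x = m x) -> vars m' (size w) i' (size hs) f' ->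
  layout m' w hs f' i' ix iy.
Proof. by case=> _ h hw hx hf hv; split=> //; apply: heap_frame hf h. Qed.

Lemma layout_weaken m w hs f i ix iy ix' iy' : ix' <= ix -> iy <= iy' ->
  layout m w hs f i ix iy -> layout m w hs f i ix' iy'.
Proof.
by move=> hx hy [hv h hw hix]; split=> //; [apply: heap_weaken h | apply: leq_trans hix].
Qed.

Lemma ends_if_bool r (c : bool -> cmd) (b : bool) (m : memory) Q : r < nvars -> m r = b ->
  ends (c b) m Q -> ends (If r (c false) (c true)) m Q.
Proof. by move=> hr hb h; apply: ends_if => //; rewrite hb; case: b {hb} h. Qed.

Lemma upd_high m r v x : r < nregs -> nregs <= x -> upd m r v x = m x.
Proof. by move=> hr hx; rewrite upd_neq //; apply: contraTneq hx => ->; rewrite -ltnNge. Qed.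

Lemma vec_upd_low m b g x : nregs <= b -> x < nregs -> vec_upd m b g x = m x.
Proof. by move=> hb hx; rewrite /vec_upd; have -> : b <= x < b + 15 = false by lia. Qed.

Lemma vars_vec_upd m b g n i h f : nregs <= b -> vars m n i h f -> vars (vec_upd m b g) n i h f.
Proof. by move=> hb [h1 h2 h3 h4 h5]; split; rewrite vec_upd_low. Qed.

(** * Moving the head and updating the vectors *)

Lemma out_edges_lt a s p : p \in out_edges a s -> p.1 < 15.
Proof.
rewrite /out_edges in_cons => /orP[/eqP->|]; first exact: delta_lt.
by case: ifP => // _; rewrite mem_seq1 => /eqP->; exact: delta_lt.
Qed.

Lemma in_edges_lt a s p : p \in in_edges a s -> p.1 < 15.
Proof. by case: p => s1 c; rewrite in_edgesP mem_iota => /andP[]. Qed.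

(** Offset 160 is 128 + 32, the suffix vector of the next site. *)
Definition back_code (a : bool) : cmd :=
  store_vec (rec_addr 32)
    (fun s => emin [seq EAdd (ELd (rec_addr (160 + p.1))) (ECst p.2) | p <- out_edges a s])
    states.

Lemma ends_back_code m w hs f i ix : i < size w -> layout m w hs f i ix i.+1 ->
  ends (back_code (nth false w i)) m (fun m' => layout m' w hs f i ix i).
Proof.
move=> hi [hv hh hw hx]; set b := 256 * size w + 128 * i + 32.
have hb : nregs <= b by rewrite /nregs /b; lia.
apply: (@ends_store_vec _ _ m b (back (128 * size w) (drop i w))) => //.
  move=> m' hm'; case: (hv) => v0 v1 _ _ _.
  have low x : x < nregs -> m' x = m x by move=> hlt; apply: hm'; lia.
  split=> [//||s hs15]; first by rewrite /= !low // v0 v1 /b; lia.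
  split.
    apply: safe_emin => p /out_edges_lt hp; split=> //; split=> //=.
    by rewrite !low // v0 v1 /nregs; lia.
  rewrite eval_emin (drop_nth false hi) back_cons low // v0; congr minl.
  apply/eq_in_map => -[p1 p2] /out_edges_lt hp; rewrite /= in hp; rewrite [LHS]/=; congr (_ + _).
  rewrite (low 0) // (low 1) // v0 v1 -(heap_back hh) //; last by lia.
  by rewrite hm'; [congr m; rewrite /=; lia | rewrite /b /=; lia].
split=> //; first exact: vars_vec_upd.
by apply: heap_set_back => //; lia.
Qed.

(** Offset 144 is 128 + 16, the prefix vector of the next site. *)
Definition fwd_code (a : bool) : cmd :=
  store_vec (rec_addr 144)
    (fun s => emin [seq EAdd (ELd (rec_addr (16 + p.1))) (ECst p.2) | p <- in_edges a s])
    states.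

Lemma ends_fwd_code m w hs f i iy : i < size w -> layout m w hs f i i iy ->
  ends (fwd_code (nth false w i)) m (fun m' => layout m' w hs f i i.+1 iy).
Proof.
move=> hi [hv hh hw hx]; set b := 256 * size w + 128 * i.+1 + 16.
have hb : nregs <= b by rewrite /nregs /b; lia.
apply: (@ends_store_vec _ _ m b (fwd (128 * size w) (take i.+1 w))) => //.
    by case: (nth false w i); vm_compute.
  move=> m' hm'; case: (hv) => v0 v1 _ _ _.
  have low x : x < nregs -> m' x = m x by move=> hlt; apply: hm'; lia.
  split=> [//||s hs15]; first by rewrite /= !low // v0 v1 /b; lia.
  split.
    apply: safe_emin => p /in_edges_lt hp; split=> //; split=> //=.
    by rewrite !low // v0 v1 /nregs; lia.
  rewrite eval_emin (take_nth false hi) /fwd foldl_rcons low // v0; congr minl.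
  apply/eq_in_map => -[p1 p2] /in_edges_lt hp; rewrite /= in hp; rewrite [LHS]/=; congr (_ + _).
  rewrite (low 0) // (low 1) // v0 v1 -/(fwd (128 * size w) (take i w)) -(heap_fwd hh) //.
  by rewrite hm'; [congr m; rewrite /=; lia | rewrite /b /=; lia].
split=> //; first exact: vars_vec_upd.
exact: heap_set_fwd.
Qed.

Definition move_left : cmd :=
  Seq (Assign rq (ESub (EVar rq) (ECst 128)))
 (Seq (Assign ri (ESub (EVar ri) (ECst 1)))
 (Seq (Assign rt (ELd (rec_addr 0)))
      (If rt (back_code false) (back_code true)))).

Lemma ends_move_left m w hs f i ix : i < size w -> layout m w hs f i.+1 ix i.+1 ->
  ends move_left m (fun m' => layout m' w hs f i ix i).
Proof.
move=> hi hinv; have [[v0 v1 v2 v3 v4] hh hw hx] := hinv.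
do 2 (apply: ends_seq; apply: ends_assign => //).
set m2 := upd _ _ _; have hv2 : vars m2 (size w) i (size hs) f.
  by split; rewrite /m2 /upd //= ?v1 ?v2; lia.
have hinv2 : layout m2 w hs f i ix i.+1.
  by apply: layout_frame hinv _ hv2 => x h; rewrite /m2 !upd_high.
case: (hinv2) => -[a0 a1 _ _ _] hh2 _ _.
have ea : eval m2 (rec_addr 0) = 256 * size w + 128 * i by rewrite /= a0 a1; lia.
apply: ends_seq; apply: ends_assign => //.
  by split=> //; rewrite ea /nregs; lia.
have -> : eval m2 (ELd (rec_addr 0)) = nth false w i by rewrite -(heap_letter hh2 hi) -ea.
set m3 := upd _ _ _; have hinv3 : layout m3 w hs f i ix i.+1.
  have hv3 : vars m3 (size w) i (size hs) f by exact: hv2.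
  by apply: layout_frame hinv2 _ hv3 => x h; rewrite /m3 upd_high.
apply: (@ends_if_bool rt back_code (nth false w i)); [by [] | by rewrite /m3 updE |].
exact: ends_back_code.
Qed.

Definition move_right : cmd :=
  Seq (Assign rt (ELd (rec_addr 0)))
 (Seq (If rt (fwd_code false) (fwd_code true))
 (Seq (Assign rq (EAdd (EVar rq) (ECst 128)))
      (Assign ri (EAdd (EVar ri) (ECst 1))))).

Lemma ends_move_right m w hs f i iy : i < size w -> layout m w hs f i i iy ->
  ends move_right m (fun m' => layout m' w hs f i.+1 i.+1 iy).
Proof.
move=> hi hinv; have [hv hh hw hx] := hinv; case: (hv) => v0 v1 v2 v3 v4.
have ea : eval m (rec_addr 0) = 256 * size w + 128 * i by rewrite /= v0 v1; lia.
apply: ends_seq; apply: ends_assign => //.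
  by split=> //; rewrite ea /nregs; lia.
have -> : eval m (ELd (rec_addr 0)) = nth false w i by rewrite -(heap_letter hh hi) -ea.
set m3 := upd _ _ _; have hinv3 : layout m3 w hs f i i iy.
  have hv3 : vars m3 (size w) i (size hs) f by exact: hv.
  by apply: layout_frame hinv _ hv3 => x h; rewrite /m3 upd_high.
apply: ends_seq.
apply: (@ends_imp _ _ (fun m' => layout m' w hs f i i.+1 iy)).
  move=> m4 h4; have [[a0 a1 a2 a3 a4] _ _ _] := h4.
  apply: ends_seq; do 2 apply: ends_assign => //.
  apply: layout_frame h4 _ _ => [x h|]; first by rewrite !upd_high.
  by split; rewrite /upd //= ?a1 ?a2; lia.
apply: (@ends_if_bool rt fwd_code (nth false w i)); [by [] | by rewrite /m3 updE |].
exact: ends_fwd_code.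
Qed.

(** * Performing, testing and recording a hop *)

Definition rewrite3 (p : config) : cmd :=
  Seq (Store (rec_addr 0) (ECst (nth false p 0)))
 (Seq (Store (rec_addr 128) (ECst (nth false p 1)))
 (Seq (Store (rec_addr 256) (ECst (nth false p 2)))
 (Seq (Assign rq (EAdd (EVar rq) (ECst 384)))
 (Seq (Assign ri (EAdd (EVar ri) (ECst 3)))
 (Seq move_left (Seq move_left move_left)))))).

(** Setting the head to [i + 3] and moving left three times recomputes the suffix vectors that
    depend on the new letters. *)
Lemma ends_rewrite3 m w hs f i p : i.+2 < size w -> size p = 3 -> layout m w hs f i i i ->
  ends (rewrite3 p) m (fun m' => layout m' (replace3 w i p) hs f i i i).
Proof.
move=> hi hp [[v0 v1 v2 v3 v4] hh hw hx].
have hs' := size_replace3 hi hp; set n := size w in v0 hs'.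
have h3 : heap (upd3 m (256 * n + 128 * i) p) (replace3 w i p) hs i i.+3.
  by apply: heap_write hh => //; lia.
have e0 (m' : memory) off : m' rS = 128 * n -> m' rq = 128 * i ->
  eval m' (rec_addr off) = 256 * n + 128 * i + off by move=> /= -> ->; lia.
apply: ends_seq; apply: ends_store => //; rewrite e0 //; first by rewrite /nregs; lia.
have lo (m' : memory) a c x : x < nregs -> nregs <= a -> upd m' a c x = m' x.
  by move=> h1 h2; rewrite upd_neq //; lia.
apply: ends_seq; apply: ends_store => //; rewrite e0 ?lo //; try by rewrite /nregs; lia.
apply: ends_seq; apply: ends_store => //; rewrite e0 ?lo //; try by rewrite /nregs; lia.
rewrite addn0 -/(upd3 m (256 * n + 128 * i) p); set m3 := upd3 _ _ _ in h3 *.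
have lo3 x : x < nregs -> m3 x = m x.
  by move=> h; rewrite /m3 /upd3 !lo // /nregs; lia.
apply: ends_seq; apply: ends_assign => //; apply: ends_seq; apply: ends_assign => //.
set m5 := upd _ _ _.
have i5 : layout m5 (replace3 w i p) hs f i.+3 i i.+3.
  split; rewrite ?hs' //; last first.
    by apply: heap_frame h3 => [|x h]; rewrite ?hs' // /m5 !upd_high.
  by split; rewrite /m5 /upd /= ?lo3 // ?v1 ?v2; lia.
have hi' : i.+2 < size (replace3 w i p) by rewrite hs'.
apply: ends_seq; apply: ends_imp (ends_move_left hi' i5) => m6 i6.
apply: ends_seq; apply: ends_imp (ends_move_left (ltnW hi') i6) => m7 i7.
exact: ends_move_left (ltnW (ltnW hi')) i7.
Qed.

Definition dot_exp : exp :=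
  emin [seq EAdd (ELd (rec_addr (16 + s))) (ELd (rec_addr (32 + s))) | s <- states].

Lemma dot_exp_ok m w hs f i : i <= size w -> layout m w hs f i i i ->
  safe m dot_exp /\ eval m dot_exp = cost (128 * size w) w.
Proof.
move=> hi [[v0 v1 _ _ _] hh hw hx]; split.
  apply: safe_emin => s _; split; split=> //=; rewrite v0 v1 /nregs; lia.
have := dot_fwd_back (128 * size w) (take i w) (drop i w); rewrite cat_take_drop => <-.
rewrite eval_emin v0; congr minl.
apply/eq_in_map => s; rewrite mem_iota => /andP[_ hlt].
rewrite -(heap_fwd hh) // -(heap_back hh) ?leqnn //= v0 v1.
by congr (m _ + m _); lia.
Qed.

Definition emit (d : bool) : cmd :=
  let a off := EAdd (EAdd (EAdd (EAdd (EVar rS) (EVar rS)) (EAdd (EVar rS) (EVar rS)))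
                      (EAdd (EVar rh) (EVar rh))) (ECst off) in
  Seq (Store (a 1) (EVar ri))
 (Seq (Store (a 2) (ECst d))
      (Assign rh (EAdd (EVar rh) (ECst 1)))).

Lemma ends_emit m w hs f i ix iy d : layout m w hs f i ix iy ->
  ends (emit d) m (fun m' => layout m' w (rcons hs (i, d)) f i ix iy).
Proof.
case=> [[v0 v1 v2 v3 v4] hh hw hx]; have hh' := heap_emit i d hw hx hh.
have lo (m' : memory) a c x : x < nregs -> nregs <= a -> upd m' a c x = m' x.
  by move=> h1 h2; rewrite upd_neq //; lia.
apply: ends_seq; apply: ends_store => //=; rewrite ?v0 ?v3; first by rewrite /nregs; lia.
have -> : 128 * size w + 128 * size w + (128 * size w + 128 * size w) + (size hs + size hs) + 1
   = 512 * size w + 2 * size hs + 1 by lia.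
apply: ends_seq; apply: ends_store => //=; rewrite !lo ?v0 ?v3 ?v2 //; try by rewrite /nregs; lia.
have -> : 128 * size w + 128 * size w + (128 * size w + 128 * size w) + (size hs + size hs) + 2
   = 512 * size w + 2 * size hs + 2 by lia.
apply: ends_assign => //=; split=> //; last first.
  by apply: heap_frame hh' => // x h; rewrite upd_high.
by split; rewrite ?updE ?size_rcons; do ?(rewrite upd_neq; last by []);
  rewrite ?lo ?v3 ?addn1 // /nregs; lia.
Qed.

Definition guarded_left : cmd := If rq Skip move_left.

Lemma ends_guarded_left m w hs f i ix : i <= size w -> layout m w hs f i ix i ->
  ends guarded_left m (fun m' => layout m' w hs f i.-1 ix i.-1).
Proof.
move=> hi h; have [[v0 v1 v2 v3 v4] _ _ _] := h.
apply: ends_if => // e; first by apply: ends_skip; have -> : i.-1 = i by lia.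
by case: i hi h v1 {v2} e => [|i] hi h v1 e; [lia | exact: ends_move_left].
Qed.

(** The hop is made tentatively and its cost read off at the head. If the truncated difference to
    the initial cost is zero, it is recorded; otherwise the window is restored. *)
Definition try_hop (d : bool) : cmd :=
  Seq (rewrite3 (win_after d))
 (Seq (Assign rt (ESub dot_exp (EVar rF)))
      (If rt (Seq (emit d) (Seq guarded_left guarded_left))
             (Seq (rewrite3 (win_before d)) move_right))).

Definition outcome (w : config) (hs : seq hop) (f i : nat) (m : memory) : Prop :=
  (exists d w', [/\ apply_hop w (i, d) = Some w', cost (128 * size w) w' <= f &
     layout m w' (rcons hs (i, d)) f (i - 2) (i - 2) (i - 2)]) \/
  ((forall d w', apply_hop w (i, d) = Some w' -> f < cost (128 * size w) w') /\
   layout m w hs f i.+1 i.+1 i.+1).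

Lemma win_before_inj : injective win_before.
Proof. by case=> [] []. Qed.

Lemma ends_try_hop m w hs f i d : i.+2 < size w -> window w i = win_before d ->
  layout m w hs f i i i -> ends (try_hop d) m (outcome w hs f i).
Proof.
move=> hi hwin hl; set w' := replace3 w i (win_after d).
have hw' : apply_hop w (i, d) = Some w' by rewrite apply_hopE hi hwin eqxx.
have hs' : size w' = size w by rewrite size_replace3 ?size_win_after.
apply: ends_seq; apply: ends_imp (ends_rewrite3 hi (size_win_after d) hl) => m1 l1.
have [|sf ef] := dot_exp_ok _ l1; first by rewrite hs'; lia.
have [hv1 _ _ _] := l1; case: (hv1) => _ _ _ _ v4.
apply: ends_seq; apply: ends_assign => //.
have -> : eval m1 (ESub dot_exp (EVar rF)) = eval m1 dot_exp - m1 rF by [].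
rewrite ef v4 hs'; set m2 := upd _ _ _.
have l2 : layout m2 w' hs f i i i.
  have hv2 : vars m2 (size w') i (size hs) f by exact: hv1.
  by apply: layout_frame l1 _ hv2 => x h; rewrite /m2 upd_high.
apply: ends_if => // [e|e].
  apply: ends_seq; apply: ends_imp (ends_emit d l2) => m3 l3.
  have hi3 : i <= size w' by lia.
  apply: ends_seq; apply: ends_imp (ends_guarded_left hi3 l3) => m4 l4.
  have hi4 : i.-1 <= size w' by lia.
  apply: ends_imp (ends_guarded_left hi4 l4) => m5 l5; left; exists d, w'; split=> //.
    by move/eqP: e; rewrite /m2 updE subn_eq0.
  have e2 : i.-1.-1 = i - 2 by lia.
  by rewrite e2 in l5; apply: layout_weaken l5 => //; lia.
have hi' : i.+2 < size w' by rewrite hs'.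
apply: ends_seq; apply: ends_imp (ends_rewrite3 hi' (size_win_before d) l2) => m3.
rewrite replace3_replace3 ?size_win_after ?size_win_before // -hwin replace3_window // => l3.
apply: ends_imp (ends_move_right _ l3) => [m4 l4|]; last by lia.
right; split; last by apply: layout_weaken l4.
(* The window determines the direction, so the rejected hop is the only one at [i]. *)
move=> d' w''; rewrite apply_hopE hwin => h; move: h; case: ifP => // /andP[_ /eqP/win_before_inj <-] [<-].
by move: e; rewrite /m2 updE subn_eq0 -ltnNge.
Qed.

(** The number of letters that differ from the window; where a peg is expected, the term is one
    minus the letter. *)
Definition mismatch (d : bool) : exp :=
  let t k := if nth false (win_before d) k then ESub (ECst 1) (ELd (rec_addr (128 * k)))
             else ELd (rec_addr (128 * k)) in
  EAdd (EAdd (t 0) (t 1)) (t 2).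

Lemma mismatch_ok m w hs f i d : i.+2 < size w -> layout m w hs f i i i ->
  safe m (mismatch d) /\ (eval m (mismatch d) = 0 <-> window w i = win_before d).
Proof.
move=> hi [[v0 v1 _ _ _] hh hw hx].
have ea k : eval m (rec_addr (128 * k)) = 256 * size w + 128 * (i + k) by rewrite /= v0 v1; lia.
have el k : k < 3 -> eval m (ELd (rec_addr (128 * k))) = nth false w (i + k).
  by move=> hk; rewrite -(heap_letter hh) -?ea //; lia.
have sf k : safe m (ELd (rec_addr (128 * k))) by split=> //; rewrite ea /nregs; lia.
have := (sf 0, sf 1, sf 2); have := (el 0 isT, el 1 isT, el 2 isT).
rewrite addn0 addn1 addn2 /mismatch /window.
move: (ELd _) (ELd _) (ELd _) => e0 e1 e2 [[h0 h1] h2] [[s0 s1] s2].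
by case: d; rewrite [win_before _]/= [nth _ _ _]/= [nth _ _ _]/= [nth _ _ _]/= [eval m _]/= h0 h1 h2;
  split; try by [do !split]; case: (nth false w i) (nth false w i.+1) (nth false w i.+2) => [] [] [].
Qed.

Definition scan_step : cmd :=
  Seq (Assign rt (mismatch true))
      (If rt (try_hop true)
             (Seq (Assign rt (mismatch false)) (If rt (try_hop false) move_right))).

Lemma ends_scan_step m w hs f i : i.+2 < size w -> layout m w hs f i i i ->
  ends scan_step m (outcome w hs f i).
Proof.
move=> hi l0; have [s0 e0] := mismatch_ok true hi l0; have [hv0 _ _ _] := l0.
apply: ends_seq; apply: ends_assign => //; set m1 := upd _ _ _.
have l1 : layout m1 w hs f i i i.
  have hv1 : vars m1 (size w) i (size hs) f by exact: hv0.
  by apply: layout_frame l0 _ hv1 => x h; rewrite /m1 upd_high.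
apply: ends_if => //; rewrite /m1 updE -/m1 => h1.
  by apply: ends_try_hop => //; apply/e0.
have [s1 e1] := mismatch_ok false hi l1; have [hv1 _ _ _] := l1.
apply: ends_seq; apply: ends_assign => //; set m2 := upd _ _ _.
have l2 : layout m2 w hs f i i i.
  have hv2 : vars m2 (size w) i (size hs) f by exact: hv1.
  by apply: layout_frame l1 _ hv2 => x h; rewrite /m2 upd_high.
apply: ends_if => //; rewrite /m2 updE -/m2 => h2.
  by apply: ends_try_hop => //; apply/e1.
apply: ends_imp (ends_move_right _ l2) => [m3 l3|]; last by lia.
right; split; last by apply: layout_weaken l3.
move=> d w' /apply_hopP[_ hw _].
by case: d hw => [/e0|/e1] h; [rewrite h in h1 | rewrite h in h2].
Qed.

(** * The scan loop and its linear running time *)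

Definition scan_left : exp := ESub (EVar rS) (EAdd (EVar rq) (ECst 256)).

Definition scan_body : cmd := Seq scan_step (Assign rt scan_left).

Definition scan : cmd := Seq (Assign rt scan_left) (While rt scan_body).

Definition scanned (w0 : config) (m : memory) : Prop :=
  exists w hs i, [/\ layout m w hs (cost (128 * size w0) w0) i i i, apply_hops w0 hs = Some w,
    clean (128 * size w0) (cost (128 * size w0) w0) w i,
    cost (128 * size w0) w <= cost (128 * size w0) w0 &
    [/\ size w <= i.+2, size w = size w0 & size hs <= size w0]].

Lemma takes_scan m w0 : layout m w0 [::] (cost (128 * size w0) w0) 0 0 0 ->
  takes scan m (csize (Assign rt scan_left) + ((csize scan_body + 2) * (4 * size w0) + 1))
    (scanned w0).
Proof.
move=> l0; set f := cost _ _ in l0 *; set n := size w0 in f l0 *.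
(* This is 128 (n - i - 2), truncated, hence nonzero exactly while a window fits at the head. *)
have eleft m' w hs i : layout m' w hs f i i i -> size w = n ->
    eval m' scan_left = 128 * n - (128 * i + 256).
  by case=> -[v0 v1 _ _ _] _ _ _ <-; rewrite /= v0 v1.
(* The variant is [3 * pegs w + (n - i)]: a hop lowers it by 3 for the lost peg and raises it by at
   most 2 for stepping back. Hops made plus pegs left is constant, which bounds the output. *)
pose I m v := exists w hs i,
  [/\ layout m w hs f i i i, apply_hops w0 hs = Some w, clean (128 * n) f w i,
    cost (128 * n) w <= f &
    [/\ m rt = 128 * n - (128 * i + 256), size w = n, i <= n,
        size hs + pegs w = pegs w0 & v = 3 * pegs w + (n - i)]].
have hp : pegs w0 <= n := count_size id w0.
apply: takes_seq; apply: ends_assign => //; set m1 := upd _ _ _.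
apply: (@takes_le _ _ ((csize scan_body + 2) * (3 * pegs w0 + n) + 1)).
  by rewrite leq_add2r leq_mul2l; apply/orP; right; lia.
apply: (@takes_while I) => //.
- exists w0, [::], 0; split=> //.
    have [hv _ _ _] := l0; have hv1 : vars m1 (size w0) 0 0 f by exact: hv.
    by apply: layout_frame l0 _ hv1 => x h; rewrite /m1 upd_high.
  by rewrite subn0 /m1 updE (eleft _ _ _ _ l0).
- move=> {m l0 m1} m v [w [hs [i [l1 ha hc hcost [et hsz hi hpegs ev]]]]] ht.
  have hi2 : i.+2 < size w by rewrite hsz; lia.
  apply: ends_seq; apply: ends_imp (ends_scan_step hi2 l1) => m1 ho.
  case: ho => [[d [w' [hw' hle l2]]]|[hno l2]].
    have hop := apply_hop_in hw'; have hsz' := hop_in_size hop; have hpg := hop_in_pegs hop.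
    have [hv2 _ _ _] := l2.
    apply: ends_assign => //; set m2 := upd _ _ _.
    exists (3 * pegs w' + (n - (i - 2))); last by lia.
    exists w', (rcons hs (i, d)), (i - 2); split=> //.
    + have hv3 : vars m2 (size w') (i - 2) (size (rcons hs (i, d))) f by exact: hv2.
      by apply: layout_frame l2 _ hv3 => x h; rewrite /m2 upd_high.
    + exact: apply_hops_rcons ha hw'.
    + exact: clean_hop hc hw'.
    + by rewrite -hsz.
    split; try (by rewrite ?size_rcons; lia).
    by rewrite /m2 updE (eleft _ _ _ _ l2) // hsz'.
  have [hv2 _ _ _] := l2.
  apply: ends_assign => //; set m2 := upd _ _ _.
  exists (3 * pegs w + (n - i.+1)); last by lia.
  exists w, hs, i.+1; split=> //.
  + have hv3 : vars m2 (size w) i.+1 (size hs) f by exact: hv2.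
    by apply: layout_frame l2 _ hv3 => x h; rewrite /m2 upd_high.
  + by apply: clean_next => //; rewrite -hsz.
  split=> //; last by lia.
  by rewrite /m2 updE (eleft _ _ _ _ l2).
move=> m2 v [w [hs [i [l2 ha hc hcost [et hsz hi hpegs ev]]]]] ht.
by exists w, hs, i; split=> //; split=> //; lia.
Qed.

(** * Loading the input and computing the initial vectors *)

(* Where the prologue leaves letter j: the first 31 letters make room for the
   registers. *)
Definition source (n j : nat) : nat := if j <= 30 then 128 * n + j else j.+1.

Definition input_at (m : memory) (w : config) : Prop :=
  [/\ m rS = 128 * size w, 0 < size w &
      forall j, j < size w -> m (source (size w) j) = nth false w j].

Definition load_body : cmd :=
  Seq (Assign rt (ESub (EVar ri) (ECst 30)))
 (Seq (If rt (Store (rec_addr 0) (ELd (EAdd (EVar rS) (EVar ri))))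
             (Store (rec_addr 0) (ELd (EAdd (EVar ri) (ECst 1)))))
 (Seq (Assign rq (EAdd (EVar rq) (ECst 128)))
 (Seq (Assign ri (EAdd (EVar ri) (ECst 1)))
      (Assign rt (ESub (EVar rS) (EVar rq)))))).

(** All sources lie below 256 n and all records above, so loading never destroys a letter still to
    be read. *)
Definition load_inv (w : config) (m : memory) (v : nat) : Prop :=
  exists i, [/\ [/\ m rS = 128 * size w, m rq = 128 * i, m ri = i, m rh = 0 &
                    m rt = 128 * size w - 128 * i],
    i <= size w, v = size w - i,
    (forall j, j < i -> m (256 * size w + 128 * j) = nth false w j) &
    (forall s, s < 15 -> m (256 * size w + 16 + s) = fwd0 (128 * size w) s) /\
    (forall j, i <= j < size w -> m (source (size w) j) = nth false w j)].

Lemma takes_load w m : 0 < size w -> load_inv w m (size w) ->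
  takes (While rt load_body) m ((csize load_body + 2) * size w + 1)
    (fun m' => layout m' w [::] (m' rF) (size w) 0 (size w).+1).
Proof.
move=> hw h0; apply: (takes_while _ h0) => // {h0} {}m v [i [[v0 v1 v2 v3 v4] hi ev hl [hf hs]]] ht.
  have hi' : i < size w by lia.
  have hlow x y z : x < nregs -> nregs <= y -> upd z y (nth false w i) x = z x.
    by move=> h1 h2; rewrite upd_neq //; lia.
  pose a := 256 * size w + 128 * i.
  have ha : nregs <= a by rewrite /a /nregs; lia.
  suff hst m1 : (forall x, x != rt -> m1 x = m x) ->
    ends (Seq (Assign rq (EAdd (EVar rq) (ECst 128)))
         (Seq (Assign ri (EAdd (EVar ri) (ECst 1)))
              (Assign rt (ESub (EVar rS) (EVar rq)))))
      (upd m1 a (nth false w i)) (fun m' => exists2 v', load_inv w m' v' & v' < v).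
    apply: ends_seq; apply: ends_assign => //; set m1 := upd _ _ _.
    have e1 x : x != rt -> m1 x = m x by move=> h; rewrite /m1 upd_neq.
    have ea : eval m1 (rec_addr 0) = a by rewrite /= !e1 // v0 v1 /a; lia.
    have hsrc := hs i; rewrite /source in hsrc.
    (* The truncated difference [i - 30] vanishes exactly for the letters that were relocated. *)
    apply: ends_seq; apply: ends_if => //; rewrite {1}/m1 updE /= v2 => hr.
      have eb : eval m1 (ELd (EAdd (EVar rS) (EVar ri))) = nth false w i.
        rewrite /= (e1 0) // (e1 2) // v0 v2 e1; last by lia.
        by move: hsrc; rewrite (_ : i <= 30 = true); [apply; lia | lia].
      apply: ends_store => //; rewrite ?ea //.
        by split=> //=; rewrite !e1 // v0 v2 /nregs; lia.
      by rewrite eb; apply: hst.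
    have eb : eval m1 (ELd (EAdd (EVar ri) (ECst 1))) = nth false w i.
      rewrite /= (e1 2) // v2 e1; last by lia.
      by move: hsrc; rewrite (_ : i <= 30 = false); [rewrite addn1; apply; lia | lia].
    apply: ends_store => //; rewrite ?ea //.
      by split=> //=; rewrite !e1 // v2 /nregs; lia.
    by rewrite eb; apply: hst.
  move=> e1; apply: ends_seq; apply: ends_assign => //; apply: ends_seq; apply: ends_assign => //.
  apply: ends_assign => //; set m2 := upd _ a _.
  have e2 x : x < nregs -> x != rt -> m2 x = m x by move=> h1 h2; rewrite /m2 hlow // e1.
  set m5 := upd _ rt _.
  have e5 x : nregs <= x -> m5 x = upd m a (nth false w i) x.
    move=> hx; rewrite /m5; do 3 (rewrite upd_high //).
    rewrite /m2 /upd; case: eqP => // _; rewrite e1 //.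
    by rewrite /nregs in hx; lia.
  exists (size w - i.+1); last by lia.
  exists i.+1; split=> //.
  - by split; rewrite /m5 /upd /= ?e2 ?v0 ?v1 ?v2 ?v3 //; lia.
  - move=> j hj; rewrite e5; last by rewrite /nregs; lia.
    rewrite /upd; case: eqP => [ej|ej]; first by congr (nat_of_bool (nth _ _ _)); rewrite /a in ej; lia.
    by apply: hl; rewrite /a in ej; lia.
  split=> [s hs15|j hj].
    rewrite e5; last by rewrite /nregs; lia.
    by rewrite upd_neq ?hf // /a; lia.
  rewrite e5; last by rewrite /source /nregs; case: ifP; lia.
  rewrite upd_neq ?hs //; first by lia.
  by rewrite /source /a; case: ifP; lia.
have ei : i = size w by lia.
rewrite {}ei in hi v1 v2 v4 hl hs.
split=> //; split=> // [j s hj hlt|j s hj]; last by lia.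
have -> : j = 0 by lia.
by rewrite muln0 addn0 hf // take0.
Qed.

Definition init_code : cmd :=
  Seq (Assign rq (ECst 0))
 (Seq (store_vec (rec_addr 16) (fun s => if s == 0 then ECst 1 else EVar rS) states)
 (Seq (Assign ri (ECst 0))
 (Seq (Assign rh (ECst 0))
      (Assign rt (EVar rS))))).

Lemma ends_init_code w m : input_at m w ->
  ends init_code m (fun m' => load_inv w m' (size w)).
Proof.
case=> v0 hw hs; apply: ends_seq; apply: ends_assign => //; set m1 := upd _ _ _.
apply: ends_seq; set b := 256 * size w + 16.
have hb : nregs <= b by rewrite /nregs /b; lia.
apply: (@ends_store_vec _ _ m1 b (fwd0 (128 * size w))) => //.
  move=> m' hm'; have low x : x < nregs -> m' x = m1 x by move=> hlt; apply: hm'; lia.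
  split=> [//||s hs15]; first by rewrite /= !low // /m1 /upd /= v0 /b; lia.
  by rewrite /fwd0; case: eqP => _ //=; rewrite low // /m1 /upd /= v0.
set m2 := vec_upd _ _ _.
have low x : x < nregs -> m2 x = m1 x by move=> h; apply: vec_upd_low.
do 2 (apply: ends_seq; apply: ends_assign => //); apply: ends_assign => //; set m5 := upd _ rt _.
have e5 x : nregs <= x -> m5 x = m2 x by move=> hx; rewrite /m5 !upd_high.
exists 0; split=> //.
- by split; rewrite /m5 /upd /= ?low // /m1 /upd /= v0 ?muln0 ?subn0.
- by rewrite subn0.
split=> [s hs15|j hj].
  rewrite e5; last by rewrite /nregs; lia.
  rewrite /m2 /vec_upd; have -> : b <= 256 * size w + 16 + s < b + 15 by rewrite /b; lia.
  by congr fwd0; rewrite /b; lia.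
have hsrc : nregs <= source (size w) j < 256 * size w.
  by rewrite /source /nregs; case: ifP; lia.
rewrite e5; last by lia.
rewrite /m2 /vec_upd; have -> : b <= source (size w) j < b + 15 = false by rewrite /b; lia.
by rewrite /m1 upd_high ?hs //; lia.
Qed.

(** The head stands behind the last letter, where the suffix is empty. *)
Definition seed_code : cmd :=
  Seq (store_vec (rec_addr 32) (fun s => if acc s then ECst 0 else EVar rS) states)
      (Assign rt (EVar rq)).

Definition back_body : cmd := Seq move_left (Assign rt (EVar rq)).

Lemma ends_seed_code w m : layout m w [::] (m rF) (size w) 0 (size w).+1 ->
  ends seed_code m (fun m' => layout m' w [::] (m rF) (size w) 0 (size w) /\ m' rt = 128 * size w).
Proof.
move=> [hv hh hw hx]; apply: ends_seq; set b := 256 * size w + 128 * size w + 32.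
have hb : nregs <= b by rewrite /nregs /b; lia.
apply: (@ends_store_vec _ _ m b (back (128 * size w) (drop (size w) w))) => //.
  case: (hv) => v0 v1 _ _ _ m' hm'.
  have low x : x < nregs -> m' x = m x by move=> hlt; apply: hm'; lia.
  split=> [//||s hs15]; first by rewrite /= !low // v0 v1 /b; lia.
  by rewrite drop_size /= /back0; case: ifP => _ //=; rewrite low // v0.
set m2 := vec_upd _ _ _.
have hv2 : vars m2 (size w) (size w) 0 (m rF) by apply: vars_vec_upd.
have l2 : layout m2 w [::] (m rF) (size w) 0 (size w).
  by split=> //; apply: heap_set_back.
apply: ends_assign => //; split; last by rewrite updE; case: hv2.
have hv3 : vars (upd m2 rt (eval m2 (EVar rq))) (size w) (size w) 0 (m rF) by exact: hv2.
by apply: layout_frame l2 _ hv3 => x h; rewrite upd_high.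
Qed.

Lemma takes_back w m f : layout m w [::] f (size w) 0 (size w) -> m rt = 128 * size w ->
  takes (While rt back_body) m ((csize back_body + 2) * size w + 1)
    (fun m' => layout m' w [::] f 0 0 0).
Proof.
move=> l0 t0.
apply: (@takes_while (fun m v => [/\ layout m w [::] f v 0 v, m rt = 128 * v & v <= size w])) => //.
  move=> {l0 t0} {}m v [l1 t1 hv] ht; case: v l1 t1 hv => [|v] l1 t1 hv; first by rewrite t1 in ht.
  apply: ends_seq; apply: ends_imp (ends_move_left hv l1) => m2 l2.
  have [hv2 _ _ _] := l2; apply: ends_assign => //.
  exists v => //; split; last exact: ltnW.
    have hv3 : vars (upd m2 rt (eval m2 (EVar rq))) (size w) v 0 f by exact: hv2.
    by apply: layout_frame l2 _ hv3 => x h; rewrite upd_high.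
  by rewrite updE; case: hv2.
by move=> {l0 t0} {}m v [l1 t1 hv] ht; move: l1; have -> : v = 0 by lia.
Qed.

Definition prepare : cmd :=
  Seq init_code (Seq (While rt load_body) (Seq seed_code
    (Seq (While rt back_body) (Assign rF dot_exp)))).

Lemma takes_prepare : exists c, forall w m, input_at m w ->
  takes prepare m (c * size w + c)
    (fun m' => layout m' w [::] (cost (128 * size w) w) 0 0 0).
Proof.
pose t n := csize init_code + ((csize load_body + 2) * n + 1 + (csize seed_code +
  ((csize back_body + 2) * n + 1 + csize (Assign rF dot_exp)))).
have [c hc] : exists c, forall n, t n <= c * n + c.
  (* The code sizes are generalised, so that the arithmetic treats them as unknown constants. *)
  rewrite /t; move: (csize _) (csize _) (csize _) (csize _) (csize _) => a b d e g.
  by exists (a + b + d + e + g + 10) => n; nia.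
exists c => w m hm; apply: takes_le (hc (size w)) _.
have hw : 0 < size w by case: hm.
apply: takes_seq; apply: takes_imp (ends_init_code hm) => m1 l1.
apply: takes_seq; apply: takes_imp (takes_load hw l1) => m2 l2.
apply: takes_seq; apply: takes_imp (ends_seed_code l2) => m3 [l3 t3].
apply: takes_seq; apply: takes_imp (takes_back l3 t3) => m4 l4.
have [|sf ef] := dot_exp_ok _ l4; first by [].
apply: ends_assign => //; rewrite ef; have [[v0 v1 v2 v3 v4] _ _ _] := l4.
move: (cost _ _) {sf ef} => fc.
by apply: layout_frame l4 _ _ => [x h|]; [rewrite upd_high | split].
Qed.

(** * Copying the list of hops to its final place *)

Definition out_base : exp := EAdd (EAdd (EVar rS) (EVar rS)) (EAdd (EVar rS) (EVar rS)).
Definition copy_left : exp := ESub (EAdd (EAdd (EVar rh) (EVar rh)) (ECst 1)) (EVar rq).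
Definition copy_body : cmd :=
  Seq (Store (EVar rq) (ELd (EAdd out_base (EVar rq))))
 (Seq (Assign rq (EAdd (EVar rq) (ECst 1)))
      (Assign rt copy_left)).

(** Only the cells from [nregs] on are filled here, the lower ones being still in use. Cell 0
    finally points to the list at 512 n, from which the epilogue fills the rest. *)
Definition output : cmd :=
  Seq (Seq (Store out_base (EVar rh)) (Seq (Assign rq (ECst nregs)) (Assign rt copy_left)))
 (Seq (While rt copy_body) (Assign rS out_base)).

Definition out_cell (hs : seq hop) (j : nat) : nat :=
  if j is j'.+1 then
    let h := nth (0, false) hs j'./2 in if odd j' then nat_of_bool h.2 else h.1
  else size hs.

Definition output_at (n : nat) (hs : seq hop) (m : memory) : Prop :=
  [/\ m rS = 512 * n,
      forall j, j <= 2 * size hs -> m (512 * n + j) = out_cell hs j &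
      forall j, nregs <= j <= 2 * size hs -> m j = out_cell hs j].

Lemma takes_output : exists c, forall w hs f i m, layout m w hs f i i i -> size hs <= size w ->
  takes output m (c * size w + c) (output_at (size w) hs).
Proof.
pose t n := csize (Seq (Store out_base (EVar rh)) (Seq (Assign rq (ECst nregs)) (Assign rt copy_left))) +
  ((csize copy_body + 2) * (2 * n + 1) + 1 + csize (Assign rS out_base)).
have [c hc] : exists c, forall n, t n <= c * n + c.
  rewrite /t; move: (csize _) (csize _) (csize _) => a b d.
  by exists (a + 2 * b + d + 10) => n; nia.
exists c => w hs f i m [[v0 v1 v2 v3 v4] hh hw hx] hsz; apply: takes_le (hc (size w)) _.
set n := size w in v0 hw hx hsz *.
have eb (m' : memory) : m' rS = 128 * n -> eval m' out_base = 512 * n by move=> /= ->; lia.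
have wb : wf nvars out_base by [].
pose I (m : memory) v := exists q, [/\ [/\ m rS = 128 * n, m rq = q, m rh = size hs &
   m rt = 2 * size hs + 1 - q], nregs <= q, v = 2 * size hs + 1 - q,
   forall j, j <= 2 * size hs -> m (512 * n + j) = out_cell hs j &
   forall j, nregs <= j < q -> j <= 2 * size hs -> m j = out_cell hs j].
apply: takes_seq.
apply: (@ends_imp _ _ (fun m' => I m' (2 * size hs + 1 - nregs))).
  move=> m1 hI.
  apply: takes_seq.
  apply: (@takes_le _ _ ((csize copy_body + 2) * (2 * size hs + 1 - nregs) + 1)).
    by rewrite leq_add2r leq_mul2l; apply/orP; right; lia.
  apply: (takes_while _ hI) => // {m1 hI} m1 v [q [[a0 a1 a2 a3] hq ev ho hl]] ht.
    have hq' : q <= 2 * size hs by lia.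
    apply: ends_seq; apply: ends_store => //.
    + by split=> //=; rewrite a0 a1 /nregs; lia.
    + by rewrite /= a1.
    have -> : eval m1 (EVar rq) = q by [].
    have -> : eval m1 (ELd (EAdd out_base (EVar rq))) = out_cell hs q.
      by rewrite -ho // -(eb m1 a0) -a1.
    apply: ends_seq; apply: ends_assign => //; apply: ends_assign => //.
    set m2 := upd m1 _ _; set m4 := upd _ rt _.
    have low x : x < nregs -> m2 x = m1 x by move=> h; rewrite /m2 upd_neq //; lia.
    have e4 x : nregs <= x -> m4 x = m2 x by move=> h; rewrite /m4 !upd_high.
    exists (2 * size hs + 1 - q.+1); last by lia.
    exists q.+1; split.
    + by split; rewrite /m4 /upd /= ?low // ?a0 ?a1 ?a2 ?a3; lia.
    + by lia.
    + by [].
    + move=> j hj; rewrite e4; last by rewrite /nregs; lia.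
      by rewrite /m2 upd_neq ?ho //; lia.
    move=> j hj hj2; rewrite e4; last by lia.
    rewrite /m2 /upd; case: eqP => [->//|hne]; apply: hl => //; lia.
  apply: ends_assign => //; rewrite eb //; split.
  + by rewrite updE.
  + by move=> j hj; rewrite upd_neq ?ho //; lia.
  move=> j hj; rewrite upd_neq; last by rewrite /nregs in hj; lia.
  by apply: hl; lia.
apply: ends_seq; apply: ends_store => //; first by rewrite eb // /nregs; lia.
rewrite eb //; apply: ends_seq; apply: ends_assign => //; apply: ends_assign => //.
set m1 := upd m _ _; set m3 := upd _ rt _.
have low x : x < nregs -> m1 x = m x.
  by move=> h; rewrite /m1 upd_neq //; rewrite /nregs in h; lia.
have e3 x : nregs <= x -> m3 x = m1 x by move=> h; rewrite /m3 !upd_high.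
exists nregs; split=> //.
+ by split; rewrite /m3 /upd /= ?low // ?v0 ?v1 ?v3 //; lia.
+ move=> j hj; rewrite e3; last by rewrite /nregs; lia.
  case: j hj => [|j] hj; first by rewrite addn0 /m1 updE.
  rewrite /m1 upd_neq; last by lia.
  have := odd_double_half j; rewrite /out_cell; set k := j./2 => ej.
  have [|o1 o2] := heap_out hh (j := k); first by move: ej; case: (odd j) => /=; lia.
  move: ej; case: (odd j) => /= ej; rewrite -?o1 -?o2; congr m; rewrite -/n; lia.
by move=> j h1 h2; lia.
Qed.

(** * Freeing and restoring the registers *)

(** Unrolled, as no cell is free for a counter: cell 0 is the pointer and cell 1 holds the constant
    1. *)
Definition save_loop (k : nat) : seq instr :=
  flatten [seq [:: Add 0 0 1; StoreI 0 j] | j <- iota 2 k].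

(* Cell 0 initially holds n and no other cell is free.  Doubling it seven times
   gives the address S = 128 n, which is beyond the input and the registers. *)
Definition prologue : seq instr :=
  nseq 7 (Add 0 0 0) ++ [:: StoreI 0 1; Const 1 1] ++ save_loop 30 ++
  [:: Const 1 30; Defs.Sub 0 0 1].

Lemma save_loop_ok m a k : m 0 = a -> m 1 = 1 -> k <= 30 -> 32 <= a ->
  let m' := exec m (save_loop k) in
  [/\ m' 0 = a + k, m' 1 = 1, forall i, 0 < i <= k -> m' (a + i) = m i.+1 &
      forall x, 1 < x -> ~~ (a < x <= a + k) -> m' x = m x].
Proof.
move=> h0 h1 hk ha; elim: k hk => [|k IH] hk m'.
  by rewrite /m' /= addn0; split=> // i; lia.
have [e0 e1 e2 e3] := IH (ltnW hk).
have -> : m' = exec (exec m (save_loop k)) [:: Add 0 0 1; StoreI 0 (2 + k)].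
  by rewrite /m' /save_loop -(addn1 k) iotaD map_cat flatten_cat exec_cat.
move: (exec m (save_loop k)) e0 e1 e2 e3 => l e0 e1 e2 e3 {m'}.
rewrite /= /upd /= e0 e1; split.
- have -> : 0 == a + k + 1 = false by lia.
  by lia.
- by have -> : 1 == a + k + 1 = false by lia.
- move=> i hi; case: eqP => [e|ne].
    have -> : i.+1 = 2 + k by lia.
    by rewrite e3 //; lia.
  have -> : a + i == 0 = false by lia.
  by apply: e2; lia.
move=> x hx hx2; have -> : x == a + k + 1 = false by lia.
have -> : x == 0 = false by lia.
by apply: e3 => //; lia.
Qed.

Lemma prologue_ok w : 0 < size w ->
  input_at (exec (Defs.mem (init_state w)) prologue) w.
Proof.
move=> hw; set m := Defs.mem _; have m0 : m 0 = size w by [].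
have hin j : j < size w -> m j.+1 = nth false w j by move=> hj; rewrite /m /= hj.
rewrite /prologue (exec_cat m (nseq 7 _)) (exec_cat _ [:: _; _]) (exec_cat _ (save_loop 30)).
set m1 := exec (exec m _) _.
have e1 : [/\ m1 0 = 128 * size w, m1 1 = 1, m1 (128 * size w) = m 1 &
    forall x, 1 < x -> x != 128 * size w -> m1 x = m x].
  have [l [el l0 lx]] : exists l, [/\ exec m (nseq 7 (Add 0 0 0)) = l,
      l 0 = 128 * size w & forall x, x != 0 -> l x = m x].
    exists (exec m (nseq 7 (Add 0 0 0))); split=> //.
      by rewrite /= /upd /= m0; lia.
    by move=> x hx; rewrite /= !upd_neq.
  rewrite /m1 el /= /upd /=; split=> //.
  - by have -> : 0 == l 0 = false by rewrite l0; lia.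
  - have -> : 128 * size w == 1 = false by lia.
    by rewrite l0 eqxx lx.
  move=> x hx hx2; have -> : x == 1 = false by lia.
  by rewrite l0 (negbTE hx2) lx //; lia.
case: e1 => a0 a1 a2 a3.
have [|b0 b1 b2 b3] := save_loop_ok a0 a1 (leqnn 30); first by lia.
move: (exec m1 (save_loop 30)) b0 b1 b2 b3 => l b0 b1 b2 b3.
have -> : exec l [:: Const 1 30; Defs.Sub 0 0 1] = upd (upd l 1 30) 0 (upd l 1 30 0 - upd l 1 30 1) by [].
split=> //; first by rewrite updE /upd /= b0 addnK.
move=> j hj; rewrite -hin //.
have hs : 1 < source (size w) j by rewrite /source; case: ifP; lia.
rewrite !upd_neq; try by lia.
rewrite /source; case: ifP => hj2; last first.
  by rewrite b3 ?a3 //; lia.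
case: j hj hj2 {hs} => [|j] hj hj2; last by rewrite b2 ?a3 //; lia.
by rewrite addn0 b3 ?a2 //; lia.
Qed.

(* Once cell 0 points to the output, cells 31 down to 2 are loaded through it, and
   finally cells 1 and 0, each serving as the pointer to its own contents. *)
Definition restore_loop (k : nat) : seq instr :=
  flatten [seq [:: Defs.Sub 0 0 1; LoadI (30 - j) 0] | j <- iota 0 k].

Definition epilogue : seq instr :=
  [:: Const 1 31; Add 0 0 1; LoadI 31 0; Const 1 1] ++ restore_loop 29 ++
  [:: Defs.Sub 0 0 1; Defs.Sub 0 0 1; Add 1 0 1; LoadI 1 1; LoadI 0 0].

Lemma restore_loop_ok m b k : m 0 = b + 31 -> m 1 = 1 -> k <= 29 -> 32 <= b ->
  let m' := exec m (restore_loop k) in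
  [/\ m' 0 = b + 31 - k, m' 1 = 1, forall x, 30 - k < x <= 30 -> m' x = m (b + x) &
      forall x, 30 < x -> m' x = m x].
Proof.
move=> h0 h1 hk hb; elim: k hk => [|k IH] hk m'.
  by rewrite /m' /= subn0; split=> // x; lia.
have [e0 e1 e2 e3] := IH (ltnW hk).
have -> : m' = exec (exec m (restore_loop k)) [:: Defs.Sub 0 0 1; LoadI (30 - k) 0].
  by rewrite /m' /restore_loop -(addn1 k) iotaD map_cat flatten_cat exec_cat.
move: (exec m (restore_loop k)) e0 e1 e2 e3 => l e0 e1 e2 e3 {m'}.
have -> : exec l [:: Defs.Sub 0 0 1; LoadI (30 - k) 0] =
  upd (upd l 0 (l 0 - l 1)) (30 - k)
    (upd l 0 (l 0 - l 1) (upd l 0 (l 0 - l 1) 0)) by [].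
rewrite updE e0 e1; set c := b + 31 - k - 1.
rewrite (@upd_neq l 0 c c); last by rewrite /c; lia.
have -> : l c = m (b + (30 - k)) by rewrite e3; [congr m | ]; rewrite /c; lia.
split.
- by rewrite upd_neq ?updE /c; lia.
- by rewrite !upd_neq //; lia.
- move=> x hx; rewrite /upd; case: eqP => [->//|ne].
  have -> : x == 0 = false by lia.
  by apply: e2; lia.
by move=> x hx; rewrite !upd_neq ?e3 //; lia.
Qed.

Lemma epilogue_ok m b x : m 0 = b -> 32 <= b ->
  exec m epilogue x = if x < 32 then m (b + x) else m x.
Proof.
move=> h0 hb; rewrite /epilogue (exec_cat m [:: _; _; _; _]) (exec_cat _ (restore_loop 29)).
set m1 := exec m _.
have e1 : [/\ m1 0 = b + 31, m1 1 = 1, m1 31 = m (b + 31) & forall x, 31 < x -> m1 x = m x].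
  rewrite /m1 /= /upd /= h0; split=> //.
    have -> : b + 31 == 0 = false by lia.
    by have -> : b + 31 == 1 = false by lia.
  move=> y hy; have -> : y == 1 = false by lia.
  have -> : y == 31 = false by lia.
  by have -> : y == 0 = false by lia.
case: e1 => a0 a1 a2 a3.
have [|b0 b1 b2 b3] := restore_loop_ok a0 a1 (leqnn 29); first by lia.
move: (exec m1 (restore_loop 29)) b0 b1 b2 b3 => l b0 b1 b2 b3.
have ep : forall y, exec l [:: Defs.Sub 0 0 1; Defs.Sub 0 0 1; Add 1 0 1; LoadI 1 1; LoadI 0 0] y =
  if y == 0 then l b else if y == 1 then l (b + 1) else l y.
  move=> y; rewrite /= /upd /= b0 b1.
  have -> : b + 31 - 29 - 1 - 1 = b by lia.
  have -> : b == 1 = false by lia.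
  have -> : b == 0 = false by lia.
  have -> : b + 1 == 1 = false by lia.
  have -> : b + 1 == 0 = false by lia.
  by case: (y == 0); case: (y == 1).
rewrite ep; case: (ltnP x 32) => hx; last first.
  have -> : x == 0 = false by lia.
  have -> : x == 1 = false by lia.
  by rewrite b3 ?a3 //; lia.
case: eqP => [->|n0]; first by rewrite addn0 b3 ?a3 //; lia.
case: eqP => [->|n1]; first by rewrite b3 ?a3 //; lia.
case: (ltnP x 31) => hx2; first by rewrite b2 ?a3 //; lia.
have -> : x = 31 by lia.
by rewrite b3 ?a2.
Qed.

(** * The whole program *)

Definition solver : cmd := Seq prepare (Seq scan output).

Lemma takes_solver : exists c, forall w m, input_at m w ->
  takes solver m (c * size w + c) (fun m' => exists v hs i,
    [/\ output_at (size w) hs m', apply_hops w hs = Some v,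
        cost (128 * size w) v <= cost (128 * size w) w,
        clean (128 * size w) (cost (128 * size w) w) v i & size v <= i.+2]).
Proof.
have [c1 h1] := takes_prepare; have [c2 h2] := takes_output.
pose t n := (c1 * n + c1) + (csize (Assign rt scan_left) +
  ((csize scan_body + 2) * (4 * n) + 1) + (c2 * n + c2)).
have [c hc] : exists c, forall n, t n <= c * n + c.
  rewrite /t; move: (csize _) (csize _) => a b.
  by exists (4 * a + 4 * b + c1 + c2 + 10) => n; nia.
exists c => w m hm; apply: takes_le (hc (size w)) _.
apply: takes_seq; apply: takes_imp (h1 _ _ hm) => m1 l1.
apply: takes_seq; apply: takes_imp (takes_scan l1) => m2.
case=> v [hs [i [l2 ha hcl hco [hi hsz hhs]]]].
rewrite -hsz in hhs; apply: takes_le; last first.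
  by apply: takes_imp (h2 _ _ _ _ _ l2 hhs) => m3; rewrite hsz => ho; exists v, hs, i.
by rewrite hsz.
Qed.

Lemma decode_output_at k (m : memory) hs :
  (forall j, j <= 2 * size hs -> m j = out_cell hs j) -> decode_output (State k m) = hs.
Proof.
move=> h; rewrite /decode_output /= (h 0) //.
apply: (@eq_from_nth _ (0, false)); first by rewrite size_mkseq.
move=> j; rewrite size_mkseq => hj; have {}hj : j < size hs by [].
rewrite nth_mkseq // !h; try by lia.
rewrite /out_cell mul2n /= doubleK uphalf_double odd_double /=.
by case: (nth _ _ _) => a [].
Qed.

(** The leading jump leaves the program at once when n = 0, where the layout would collapse.
    Arbitrary [pre], [post] and [c] keep the concrete code folded. *)
Lemma assemble (pre post : seq instr) (c : cmd) : exists P,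
  [/\ size P = (size pre).+1 + csize c + size post, nth Halt P 0 = Jz 0 (size P),
      code_at P 1 pre, code_at P (size pre).+1 (compile (size pre).+1 c) &
      code_at P ((size pre).+1 + csize c) post].
Proof.
set k := (size pre).+1; set j := Jz 0 (k + csize c + size post).
exists (j :: pre ++ compile k c ++ post).
have hsz : size (j :: pre ++ compile k c ++ post) = k + csize c + size post.
  by rewrite /= !size_cat size_compile addnA addSn.
split=> //; first by rewrite hsz.
- by exists [:: j], (compile k c ++ post).
- by exists (j :: pre), post.
exists (j :: pre ++ compile k c), [::].
by rewrite cats0 /= -catA size_cat size_compile addSn.
Qed.

Lemma step_halt P k m : size P <= k -> step P (State k m) = None.
Proof. by move=> h; rewrite /step /= nth_default. Qed.

Theorem theorem2 :
  exists (P : seq instr) (c : nat),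
    forall w : config,
      exists fin : state,
        run (c * size w + c) P (init_state w) = Some fin /\
        exists v : config,
          apply_hops w (decode_output fin) = Some v /\
          (forall v' : config, reachable w v' -> pegs v <= pegs v').
Proof.
have [c hc] := takes_solver.
have [P [hsz hjz hpro hsol hepi]] := assemble prologue epilogue solver.
pose t n := 1 + size prologue + (c * n + c) + size epilogue.
have [c' hc'] : exists c', forall n, t n <= c' * n + c'.
  exists (c + size prologue + size epilogue + 1) => n; rewrite /t.
  by move: (size _) (size _) => a b; nia.
exists P, c' => w; case: (posnP (size w)) => hw.
  case: w hw => // _; exists (State (size P) (Defs.mem (init_state [::]))); split.
    apply: (@steps_run _ 1); [by rewrite /= /step /= hjz | exact: step_halt |].
    by apply: leq_trans (hc' _); rewrite /t -!addnA leq_addr.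
  by exists [::].
set m0 := Defs.mem (init_state w).
have r0 := reaches_jz m0 hjz; have m00 : m0 0 = size w by [].
rewrite m00 (gtn_eqF hw) in r0.
have r1 := reaches_straight m0 hpro isT.
have [m hd [v [hs [i [ho ha hco hcl hi]]]]] := hc _ _ (prologue_ok hw).
have [l hl r2] := hd _ _ _ hsol (fun x _ => erefl).
have r3 := reaches_straight l hepi isT.
have [t' ht' hst] := reaches_trans (reaches_trans (reaches_trans r0 r1) r2) r3.
exists (State ((size prologue).+1 + csize solver + size epilogue) (exec l epilogue)); split.
  apply: (steps_run hst); last exact: leq_trans ht' (hc' _).
  by apply: step_halt; rewrite hsz leqnn.
case: ho => o0 o1 o2; exists v; split.
  rewrite (@decode_output_at _ _ hs) // => j hj.
  have low x : ~~ (nvars <= x < nregs) -> l x = m x by move=> h; rewrite -hl.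
  have l0 : l 0 = 512 * size w by rewrite low.
  rewrite (epilogue_ok j l0); last by lia.
  (* Cells below 32 were loaded from 512 n by the epilogue, the others were copied by the loop. *)
  case: ltnP => hx; rewrite low ?o1 ?o2 //; rewrite /nvars /nregs; lia.
(* For a nonempty [w] the infinity 128 n exceeds its length, as optimality requires. *)
apply: (@clean_optimal (128 * size w) w v i) => //; try lia.
by exists hs.
Qed.
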